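(* For any interval $I=(\mu_1,\mu_2)$, $-\infty\le\mu_1<\mu_2\le\infty$, and for any $d\in\mathbb N$ (i.e. $d\geq 1$) there exist a separable Hilbert space $\mathfrak H$ and a closed, densely defined, simple symmetric operator $A$ in $\mathfrak H$ such that $n_+(A)=n_-(A)=d$, $\dim\operatorname{Ker}(A^*-\lambda)=d$ for every $\lambda\in I$ (i.e. $\widetilde\rho_I(A)=I$), and for any self-adjoint extension $\widetilde A\supset A$ (in $\mathfrak H$) the interval $I$ contains infinitely many points of the essential spectrum $\sigma_e(\widetilde A)$. Consequently, the set $\widetilde\rho_I(A)\setminus\hat\rho_I(A)$ is infinite.
   Context: A symmetric operator $A$ is simple if there is no nonzero closed subspace reducing $A$ on which $A$ is self-adjoint. The deficiency indices are $n_\pm(A)=\dim\operatorname{Ker}(A^*-z)$ for $z\in\mathbb C_\pm$ (upper/lower half-plane). For a symmetric operator $A$ with $d=n_\pm(A)<\infty$ and an interval $I$, $\widetilde\rho_I(A)=\{\lambda\in I:\dim\operatorname{Ker}(A^*-\lambda)=d\}$, and $\hat\rho_I(A)=\hat\rho(A)\cap I$, where $\hat\rho(A)=\{\lambda\in\mathbb C:\operatorname{Ker}(A-\lambda)=\{0\},\ \mathcal R(A-\lambda)\text{ is closed}\}$ is the set of regular type points ($\mathcal R$ denotes the range). For a self-adjoint operator $T$ the discrete spectrum $\sigma_d(T)$ is the set of all isolated eigenvalues of $T$ with finite multiplicity (isolated as points of $\sigma(T)$), and $\sigma_e(T)=\sigma(T)\setminus\sigma_d(T)$ is the essential spectrum.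 *)

(* Defs.v *)
From HB Require Import structures.
From mathcomp Require Import all_boot all_order all_algebra sesquilinear.
From mathcomp Require Import all_classical all_reals all_analysis.
From mathcomp Require Import complex.

Set Implicit Arguments.
Unset Strict Implicit.
Unset Printing Implicit Defensive.

Import Order.TTheory GRing.Theory Num.Theory.
Import numFieldNormedType.Exports.

Local Open Scope classical_set_scope.
Local Open Scope ring_scope.
Local Open Scope complex_scope.

(* The inner product is linear in its first argument and conjugate-linear   *)
(* in the second.  Norms are R[i]-valued, with real nonnegative values.     *)
Record hilbertSpace (R : realType) := HilbertSpace {
  hilbert_sort :> completeNormedModType R[i] ;
  inner : {dot hilbert_sort for (@Num.conj R[i])} ;
  inner_norm : forall x : hilbert_sort, `|x| ^+ 2 = inner x x
}.

Arguments inner {R h}.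

Definition separable (T : topologicalType) :=
  exists S : set T, countable S /\ dense S.

Section Subspaces.
Variables (K : fieldType) (V : lmodType K).

Definition subspace (M : set V) :=
  M 0 /\ forall (a : K) (x y : V), M x -> M y -> M (a *: x + y).

Definition has_dim (M : set V) (n : nat) :=
  exists e : 'I_n -> V,
    (forall c : 'I_n -> K, \sum_(i < n) c i *: e i = 0 -> forall i, c i = 0) /\
    M = [set x | exists c : 'I_n -> K, x = \sum_(i < n) c i *: e i].

End Subspaces.

(* A (possibly unbounded) operator is represented by its graph               *)
(* T = {(x, T x) | x in dom T}, so that inclusion of operators is inclusion  *)
(* of graphs and equality of operators is equality of sets.                  *)
Section Operators.
Variables (R : realType) (H : hilbertSpace R).
Implicit Types (A T : set (H * H)) (M : set H) (z : R[i]).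

Definition operator T :=
  subspace T /\ forall x y1 y2, T (x, y1) -> T (x, y2) -> y1 = y2.

Definition dom T : set H := [set x | exists y, T (x, y)].

(* (x, y) is in the graph of T^* iff <T u, x> = <u, y> for all u in dom T.   *)
(* This is single-valued when dom T is dense.                                *)
Definition adjoint T : set (H * H) :=
  [set p | forall u v, T (u, v) -> inner v p.1 = inner u p.2].

Definition symmetric_operator T :=
  forall x y u v, T (x, y) -> T (u, v) -> inner y u = inner x v.

Definition selfadjoint T :=
  [/\ operator T, dense (dom T) & T = adjoint T].

Definition ker T z : set H := [set x | T (x, z *: x)].

Definition ran T z : set H := [set p.2 - z *: p.1 | p in T].

Definition orthogonal_complement M : set H :=
  [set y | forall x, M x -> inner x y = 0].

Definition part M T : set (H * H) := T `&` (M `*` M).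

(* M reduces T: T is the orthogonal sum of its parts in M and in the         *)
(* orthogonal complement of M.                                               *)
Definition reduces M T :=
  forall p, T p -> exists q r,
    [/\ part M T q, part (orthogonal_complement M) T r & p = q + r].

(* T, acting inside M, is self-adjoint in the Hilbert space M.               *)
Definition selfadjoint_in M T :=
  [/\ operator T, T `<=` M `*` M, M `<=` closure (dom T)
    & T = part M (adjoint T)].

Definition simple_operator T :=
  ~ exists M, [/\ subspace M, closed M, M <> [set 0], reduces M T
                & selfadjoint_in M (part M T)].

(* n_+(T) = np and n_-(T) = nm *)
Definition deficiency_indices T (np nm : nat) :=
  (forall z, 0 < complex.Im z -> has_dim (ker (adjoint T) z) np) /\
  (forall z, complex.Im z < 0 -> has_dim (ker (adjoint T) z) nm).

Definition regular_type_points T : set R[i] :=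
  [set z | ker T z = [set 0] /\ closed (ran T z)].

Definition rho_hat (I : set R) T : set R :=
  [set l | I l /\ regular_type_points T l%:C].

Definition rho_tilde (I : set R) T : set R :=
  [set l | I l /\ exists d, deficiency_indices T d d /\
                            has_dim (ker (adjoint T) l%:C) d].

Definition resolvent_set T : set R[i] :=
  [set z | [/\ ker T z = [set 0], ran T z = setT
             & exists c : R[i],
                 forall x y, T (x, y) -> `|x| <= c * `|y - z *: x|]].

(* R[i]^o is R[i] with the topology given by its norm. *)
Definition spectrum T : set R[i]^o := ~` resolvent_set T.

Definition discrete_spectrum T : set R[i]^o :=
  [set z | [/\ isolated (spectrum T) z, ker T z <> [set 0]
             & exists n, has_dim (ker T z) n]].

Definition essential_spectrum T : set R[i]^o :=
  spectrum T `\` discrete_spectrum T.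

End Operators.

Definition open_interval (R : realType) (mu1 mu2 : \bar R) : set R :=
  [set l | (mu1 < l%:E)%E /\ (l%:E < mu2)%E].

(* Main.v *)
Require Import Defs.
From HB Require Import structures.
From mathcomp Require Import all_boot all_order all_algebra sesquilinear.
From mathcomp Require Import all_classical all_reals all_analysis.
From mathcomp Require Import complex ring lra.
Import Order.TTheory GRing.Theory Num.Theory.
Import numFieldNormedType.Exports.
Local Open Scope classical_set_scope.
Local Open Scope ring_scope.
Local Open Scope complex_scope.

Set Implicit Arguments.
Unset Strict Implicit.
Unset Printing Implicit Defensive.

(** The operator is a restriction of a diagonal one.  Let (e_k) be an
    orthonormal basis, a_k distinct real numbers, phi_k positive weights, and
    let the residue of k modulo d be the colour of k.  The operator A multiplies
    the k-th coefficient by a_k, on a domain cut down by d conditions, one for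
    each colour: the sum of phi_k x_k over that colour vanishes.  Its adjoint
    consists of the pairs (x, y) such that y_k - a_k x_k is phi_k times a
    constant depending only on the colour of k.  To avoid conditionally
    defined sums, this adjoint is taken as the primitive object
    ([maximal_op]) and A is defined as its adjoint ([minimal_op]).  The
    vectors phi_l e_k - phi_k e_l, with k and l of one colour, belong to the
    domain of A, and testing against them suffices to prove that the adjoint
    of A is [maximal_op] ([adjoint_minimal_op]).

    The equation (z - a_k) x_k = c phi_k shows that every colour contributes
    exactly one dimension to the kernel of A* - z, spanned by
    phi_k / (z - a_k) or, if z = a_j, by e_j, as soon as phi_k / (z - a_k) is
    square summable ([has_dim_ker_maximal]).  So the point is to make the a_k
    accumulate at infinitely many points of I while this sequence remains
    square summable for all complex z, those points included.  The a_k
    approach alpha + r 2^-(m+1), for each m, at distance of the order of 2^-k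
    (with a factor depending on m), whereas phi_k = 4^-k; every other z also
    stays at distance at least c 2^-k, with c > 0, from these a_k for large k
    ([node_lower_bound]).  Along a subsequence of every colour, a_k is
    instead alpha + r 4^k, of weight phi_k = 2^k: the weights being unbounded,
    the domain of A is dense ([minimal_op_dense]).

    Essential spectrum.  On phi_l e_k - phi_k e_l the operator differs from
    multiplication by (a_k + a_l) / 2 by at most |a_k - a_l| / 2, in
    relative norm.  A self-adjoint extension T of A extends this estimate, and
    an approximate eigenvector of a self-adjoint operator forces spectrum
    nearby ([selfadjoint_spectrum_near]).  Hence T has spectrum between any
    two a_k, a_l of one colour, so that an accumulation point of the a_k is
    in the spectrum and is not isolated there
    ([essential_spectrum_accumulation]).  At these points the range of A is
    not closed either: a suitable y in the closure of the range would have a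
    preimage with infinitely many coefficients equal to 1
    ([minimal_op_ran_not_closed]).

    Simplicity.  If A is self-adjoint on a closed subspace M, the projection
    of e_k to M is an eigenvector of A for a_k; it is therefore a multiple of
    e_k, but no nonzero multiple of e_k is in the domain of A.  So M is
    orthogonal to all e_k ([minimal_op_simple]). *)

(** * Norm of a complex scalar product *)

Section DotNorm.
Variables (C : numClosedFieldType) (U : lmodType C).
Variable (form : {dot U for (@Num.conj C)}).

(** Subtract from u its projection a v to the line of v and use that the
    difference has nonnegative square. *)
Lemma dot_CauchySchwarz u v : `|form u v| ^+ 2 <= form u u * form v v.
Proof.
have [->|v0] := eqVneq v 0; first by rewrite !(linear0r form) normr0 expr0n mulr0.
have fv : 0 < form v v by rewrite dnorm_gt0.
set a := form u v / form v v.
have ov : form (u - a *: v) (a *: v) = 0.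
  rewrite linearZr_LR /= linearBl /= linearZl_LR /= /a divfK ?gt_eqF //.
  by rewrite subrr mulr0.
have -> : form u u = form (u - a *: v) (u - a *: v) + `|a| ^+ 2 * form v v.
  by rewrite -dnormZ; have := hnormDd ov; rewrite subrK.
rewrite mulrDl.
rewrite /a normf_div expr_div_n (ger0_norm (ltW fv)) expr2.
have -> : `|form u v| ^+ 2 / (form v v * form v v) * form v v * form v v =
          `|form u v| ^+ 2.
  by rewrite -mulrA divfK // mulf_neq0 // gt_eqF.
by rewrite lerDr mulr_ge0 // dnorm_ge0.
Qed.

Definition dot_norm u := sqrtC (form u u).

Lemma dot_norm_triangle u v : dot_norm (u + v) <= dot_norm u + dot_norm v.
Proof.
have n0 w : 0 <= dot_norm w by exact: sqrt_dnorm_ge0.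
rewrite -(@ler_pXn2r _ 2%N) ?nnegrE ?addr_ge0 //.
rewrite /dot_norm sqrtCK sqrrD !sqrtCK dnormD addrAC lerD2r lerD2l.
apply: (le_trans (y := `|form u v| *+ 2)).
  have r : form u v + (form u v)^* \is Num.real.
    by rewrite CrealE rmorphD /= conjCK addrC.
  apply: le_trans (real_ler_norm r) _; apply: le_trans (ler_normD _ _) _.
  by rewrite norm_conjC mulr2n.
rewrite lerMn2r /= -(@ler_pXn2r _ 2%N) ?nnegrE ?mulr_ge0 //.
  by rewrite exprMn !sqrtCK dot_CauchySchwarz.
all: exact: n0.
Qed.

Lemma dot_normZ a u : dot_norm (a *: u) = `|a| * dot_norm u.
Proof.
rewrite /dot_norm dnormZ sqrtCM ?nnegrE ?exprn_ge0 ?dnorm_ge0 //.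
by rewrite sqrCK.
Qed.

Lemma dot_norm_eq0 u : dot_norm u = 0 -> u = 0.
Proof. by move/eqP; rewrite sqrt_dnorm_eq0 => /eqP. Qed.

End DotNorm.

(** * Complex series and square summable sequences *)

Section ComplexSeries.
Variable R : realType.
Implicit Types (u v : nat -> R[i]).

Definition csummable u :=
  cvgn (series (fun k => complex.Re (u k))) /\
  cvgn (series (fun k => complex.Im (u k))).

(** Real and imaginary parts are summed separately, so that only real series
    are involved. *)
Definition csum u : R[i] :=
  limn (series (fun k => complex.Re (u k))) +i*
  limn (series (fun k => complex.Im (u k))).

Lemma csummableD u v : csummable u -> csummable v ->
  csummable (fun k => u k + v k) /\
  csum (fun k => u k + v k) = csum u + csum v.
Proof.
move=> [ru iu] [rv iv]; rewrite /csummable /csum.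
rewrite (_ : (fun k => complex.Re (u k + v k)) =
  (fun k => complex.Re (u k)) + (fun k => complex.Re (v k))); last first.
  by apply/funext => k; rewrite raddfD.
rewrite (_ : (fun k => complex.Im (u k + v k)) =
  (fun k => complex.Im (u k)) + (fun k => complex.Im (v k))); last first.
  by apply/funext => k; rewrite raddfD.
split; first by split; apply: is_cvg_seriesD.
by rewrite !lim_seriesD.
Qed.

Lemma csummableZ a u : csummable u ->
  csummable (fun k => a * u k) /\ csum (fun k => a * u k) = a * csum u.
Proof.
case: a => a b [ru iu]; rewrite /csummable /csum.
rewrite (_ : (fun k => complex.Re ((a +i* b) * u k)) =
  (a *: (fun k => complex.Re (u k)) : nat -> R) -
  b *: (fun k => complex.Im (u k))); last first.
  by apply/funext => k; rewrite !fctE /= /GRing.scale /=; case: (u k).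
rewrite (_ : (fun k => complex.Im ((a +i* b) * u k)) =
  (a *: (fun k => complex.Im (u k)) : nat -> R) +
  b *: (fun k => complex.Re (u k))); last first.
  by apply/funext => k; rewrite !fctE /= /GRing.scale /=; case: (u k).
have hZ (c : R) (f : nat -> R) : cvgn (series f) -> cvgn (series (c *: f)).
  exact: is_cvg_seriesZ.
split; first by split; [apply: is_cvg_seriesB|apply: is_cvg_seriesD]; apply: hZ.
rewrite (lim_seriesB (hZ a _ ru) (hZ b _ iu)).
by rewrite (lim_seriesD (hZ a _ iu) (hZ b _ ru)) !lim_seriesZ.
Qed.

Lemma csummable_conj u : csummable u ->
  csummable (fun k => Num.conj (u k)) /\
  csum (fun k => Num.conj (u k)) = Num.conj (csum u).
Proof.
move=> [ru iu]; rewrite /csummable /csum.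
rewrite (_ : (fun k => complex.Re (Num.conj (u k))) =
  (fun k => complex.Re (u k))); last first.
  by apply/funext => k; case: (u k).
rewrite (_ : (fun k => complex.Im (Num.conj (u k))) =
  - (fun k => complex.Im (u k))); last first.
  by apply/funext => k; rewrite !fctE; case: (u k).
split; first by split => //; rewrite is_cvg_seriesN.
by rewrite lim_seriesN.
Qed.

Definition sqmod (z : R[i]) : R := complex.Re z ^+ 2 + complex.Im z ^+ 2.

Lemma sqmodE z : (sqmod z)%:C = `|z| ^+ 2.
Proof. exact: add_Re2_Im2. Qed.

Lemma sqmod_ge0 z : 0 <= sqmod z.
Proof. by rewrite addr_ge0 ?sqr_ge0. Qed.

Definition sqsummable u := cvgn (series (fun k => sqmod (u k))).

Lemma sqsummable_le u (w : nat -> R) :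
  (forall k, sqmod (u k) <= w k) -> cvgn (series w) -> sqsummable u.
Proof.
move=> h; apply: series_le_cvg => // k; first exact: sqmod_ge0.
by apply: le_trans (h k); exact: sqmod_ge0.
Qed.

Lemma sqmodM a z : sqmod (a * z) = sqmod a * sqmod z.
Proof. by apply: complexI; rewrite rmorphM /= !sqmodE normrM exprMn. Qed.

Lemma sqmodV (z : R[i]) : sqmod z^-1 = (sqmod z)^-1.
Proof.
by apply: complexI; rewrite [RHS]fmorphV /= !sqmodE normfV exprVn.
Qed.

Lemma sqmod_conj (z : R[i]) : sqmod (Num.conj z) = sqmod z.
Proof. by case: z => p q; rewrite /sqmod /= sqrrN. Qed.

Lemma sqmod_real (r : R) : sqmod r%:C = r ^+ 2.
Proof. by rewrite /sqmod /= expr0n addr0. Qed.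

Lemma sqmodD_le y z : sqmod (y + z) <= 2 * sqmod y + 2 * sqmod z.
Proof.
case: y z => [a b] [c d]; rewrite /sqmod /=.
by have := sqr_ge0 (a - c); have := sqr_ge0 (b - d); nra.
Qed.

Lemma sqsummable_combination a u v : sqsummable u -> sqsummable v ->
  sqsummable (fun k => a * u k + v k).
Proof.
move=> su sv; apply: (sqsummable_le (w :=
  ((2 * sqmod a) *: (fun k => sqmod (u k)) : nat -> R) +
  2 *: (fun k => sqmod (v k)))).
  by move=> k; apply: le_trans (sqmodD_le _ _) _; rewrite sqmodM mulrA.
by apply: is_cvg_seriesD; apply: is_cvg_seriesZ.
Qed.

Lemma csummable_dot u v : sqsummable u -> sqsummable v ->
  csummable (fun k => u k * Num.conj (v k)).
Proof.
move=> su sv.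
have c : cvgn (series ((fun k => sqmod (u k)) + (fun k => sqmod (v k)))).
  exact: is_cvg_seriesD.
have b y z : `|complex.Re (y * Num.conj z)| <= sqmod y + sqmod z /\
             `|complex.Im (y * Num.conj z)| <= sqmod y + sqmod z.
  case: y z => [p q] [r s]; rewrite /sqmod /= mulrN opprK !ler_norml.
  have := sqr_ge0 (p - r); have := sqr_ge0 (q - s).
  have := sqr_ge0 (p + r); have := sqr_ge0 (q + s).
  have := sqr_ge0 (p - s); have := sqr_ge0 (q - r).
  have := sqr_ge0 (p + s); have := sqr_ge0 (q + r).
  have := sqr_ge0 p; have := sqr_ge0 q; have := sqr_ge0 r; have := sqr_ge0 s.
  by rewrite !expr2 => *; split; apply/andP; split; lra.
split; apply: normed_cvg; apply: series_le_cvg c => k //=.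
- by rewrite addr_ge0 ?sqmod_ge0.
- by have [] := b (u k) (v k).
- by rewrite addr_ge0 ?sqmod_ge0.
- by have [] := b (u k) (v k).
Qed.

End ComplexSeries.
(** * The Hilbert space of square summable sequences *)

Section L2Type.
Variable R : realType.

(** The closure of square summability under linear combinations is stated for
    a boolean predicate so that l2 inherits its module structure from the
    space of all sequences. *)
Definition sqsummable_pred : {pred nat -> R[i]} := fun u => `[< sqsummable u >].

Lemma sqsummable_submod : submod_closed sqsummable_pred.
Proof.
split=> [|a u v /asboolP su /asboolP sv]; apply/asboolP; last first.
  exact: sqsummable_combination.
apply: (sqsummable_le (w := fun=> 0)) => [k|].
  by rewrite /sqmod /= expr0n addr0.
rewrite (_ : series _ = fun=> 0); first exact: is_cvg_cst.
by apply/funext => n; rewrite seriesEnat /= big1.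
Qed.

HB.instance Definition _ :=
  GRing.isSubmodClosed.Build R[i] (nat -> R[i]) sqsummable_pred
    sqsummable_submod.

Record l2 := L2 { l2_val :> nat -> R[i]; _ : l2_val \in sqsummable_pred }.

HB.instance Definition _ := [isSub for l2_val].
HB.instance Definition _ := [Choice of l2 by <:].
HB.instance Definition _ := [SubChoice_isSubLmodule of l2 by <:].

Implicit Types (x y : l2).

Lemma l2_sqsummable x : sqsummable x.
Proof. by case: x => u /= /asboolP. Qed.

Arguments l2_sqsummable : clear implicits.

Definition mkl2 (u : nat -> R[i]) (h : sqsummable u) : l2 :=
  L2 (introT (asboolP _) h).

Lemma l2P x y : (forall k, x k = y k) -> x = y.
Proof. by move=> h; apply/val_inj/funext. Qed.

Lemma l2D x y k : (x + y) k = x k + y k. Proof. by []. Qed.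
Lemma l2B x y k : (x - y) k = x k - y k. Proof. by []. Qed.
Lemma l2Z (a : R[i]) x k : (a *: x) k = a * x k. Proof. by []. Qed.
Lemma l20 k : (0 : l2) k = 0. Proof. by []. Qed.

Definition l2_dot x y : R[i] := csum (fun k => x k * Num.conj (y k)).

Lemma l2_dot_is_bilinear :
  bilinear_for (GRing.Scale.Law.clone _ _ *%R _)
    (GRing.Scale.Law.clone _ _ (Num.conj \; *%R) _) l2_dot.
Proof.
have S x y := csummable_dot (l2_sqsummable x) (l2_sqsummable y).
split=> [z a x y|x a y z] /=.
  have [Sx Ex] := csummableZ a (S x z).
  rewrite -Ex -(csummableD Sx (S y z)).2 /l2_dot; congr csum.
  by apply/funext => k; rewrite l2D l2Z mulrDl mulrA.
have [Sy Ey] := csummableZ (Num.conj a) (S x y).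
rewrite -Ey -(csummableD Sy (S x z)).2 /l2_dot; congr csum.
by apply/funext => k; rewrite l2D l2Z rmorphD rmorphM mulrDr mulrCA.
Qed.

HB.instance Definition _ :=
  bilinear_isBilinear.Build R[i] l2 l2 R[i] _ _ l2_dot l2_dot_is_bilinear.

Lemma l2_dot_herm x y :
  l2_dot x y = (-1) ^+ false * Num.conj (l2_dot y x).
Proof.
rewrite mul1r.
have [_ <-] := csummable_conj (csummable_dot (l2_sqsummable y) (l2_sqsummable x)).
by congr csum; apply/funext => k; rewrite rmorphM /= conjCK mulrC.
Qed.

HB.instance Definition _ :=
  isHermitianSesquilinear.Build R[i] l2 false Num.conj l2_dot l2_dot_herm.

(** The square of the norm, before the norm exists. *)
Definition l2_sq x : R := limn (series (fun k => sqmod (x k))).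

Lemma l2_dotE x : l2_dot x x = (l2_sq x)%:C.
Proof.
rewrite /l2_dot /csum /l2_sq; congr (_ +i* _).
  rewrite (_ : (fun k => complex.Re _) = (fun k => sqmod (x k))) //.
  apply/funext => k; by case: (x k) => a b; rewrite /sqmod /= mulrN opprK -!expr2.
rewrite (_ : series _ = fun=> 0) ?lim_cst //.
apply/funext => n; rewrite seriesEnat /= big1 // => k _.
by case: (x k) => a b /=; rewrite mulrN mulrC addNr.
Qed.

Lemma l2_partial_le x n : series (fun k => sqmod (x k)) n <= l2_sq x.
Proof.
apply: nondecreasing_cvgn_le; last exact: l2_sqsummable.
by apply: nondecreasing_series => k _ _; exact: sqmod_ge0.
Qed.

Lemma l2_coord_le x k : sqmod (x k) <= l2_sq x.
Proof.
apply: le_trans (l2_partial_le x k.+1).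
by rewrite seriesSr lerDr seriesEnat sumr_ge0 // => i _; exact: sqmod_ge0.
Qed.

Lemma sqmod_eq0 (z : R[i]) : sqmod z <= 0 -> z = 0.
Proof.
move=> h; apply/eqP; rewrite -normr_eq0 -sqrf_eq0 -sqmodE.
suff -> : sqmod z = 0 by [].
by apply/le_anti; rewrite h sqmod_ge0.
Qed.

Lemma l2_dot_gt0 x : x != 0 -> 0 < l2_dot x x.
Proof.
move=> x0; rewrite l2_dotE ltcR lt_neqAle; apply/andP; split; last first.
  by apply: le_trans (l2_coord_le x 0); exact: sqmod_ge0.
apply: contra_neq x0 => h; apply: l2P => k; apply: sqmod_eq0.
by rewrite h l2_coord_le.
Qed.

HB.instance Definition _ := isDotProduct.Build R[i] l2 l2_dot l2_dot_gt0.

Let form : {dot l2 for (@Num.conj R[i])} := l2_dot.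

HB.instance Definition _ := Lmodule_isNormed.Build R[i] l2
  (dot_norm_triangle form) (dot_normZ form) (@dot_norm_eq0 _ _ form).

Lemma l2_normE x : `|x| ^+ 2 = (l2_sq x)%:C.
Proof. by rewrite -l2_dotE /Num.norm /= /dot_norm sqrtCK. Qed.

End L2Type.
(** * Real-valued norm *)

Section RealNorm.
Variables (R : realType) (V : normedModType R[i]).
Implicit Types (x y z : V).

Lemma gt0_complexP (e : R[i]) : 0 < e -> exists2 r : R, 0 < r & e = r%:C.
Proof.
by case: e => r i; rewrite ltcE /= => /andP[/eqP -> r0]; exists r.
Qed.

Lemma ltr0C (r : R) : (0 < r%:C) = (0 < r).
Proof. exact: ltcR. Qed.

(** The norm of a complex normed module is complex-valued and only partially
    ordered; its real part is used for all estimates. *)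
Definition rnorm x : R := complex.Re `|x|.

Lemma rnormE x : (rnorm x)%:C = `|x|.
Proof. by rewrite /rnorm RRe_real // normr_real. Qed.

Lemma rnorm_ge0 x : 0 <= rnorm x.
Proof. by rewrite -ler0c rnormE. Qed.

Lemma rnormD x y : rnorm (x + y) <= rnorm x + rnorm y.
Proof. by rewrite -lecR rmorphD /= !rnormE ler_normD. Qed.

Lemma rnormN x : rnorm (- x) = rnorm x.
Proof. by rewrite /rnorm normrN. Qed.

Lemma rnormB x y : rnorm (x - y) = rnorm (y - x).
Proof. by rewrite -rnormN opprB. Qed.

Lemma rnorm_triangle y x z : rnorm (x - z) <= rnorm (x - y) + rnorm (y - z).
Proof. by apply: le_trans (rnormD _ _); rewrite addrA subrK. Qed.

Lemma rnormZ (a : R[i]) x : rnorm (a *: x) = complex.Re `|a| * rnorm x.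
Proof.
rewrite /rnorm normrZ; have /complex_realP [r ->] := normr_real a.
by case: `|x| => p q /=; rewrite mul0r subr0.
Qed.

Lemma rnorm_eq0 x : rnorm x = 0 -> x = 0.
Proof. by move=> h; apply/normr0_eq0; rewrite -rnormE h. Qed.

Lemma rnorm_gt0 x : x != 0 -> 0 < rnorm x.
Proof.
move=> x0; rewrite lt_neqAle rnorm_ge0 andbT eq_sym.
by apply: contra_neq x0; exact: rnorm_eq0.
Qed.

Lemma ball_rnorm x (r : R) y : ball x r%:C y = (rnorm (x - y) < r) :> Prop.
Proof. by rewrite -ball_normE /= -rnormE ltcR. Qed.

Lemma nbhs_rnormP x (P : set V) :
  nbhs x P <-> exists2 r : R, 0 < r & forall y, rnorm (x - y) < r -> P y.
Proof.
split=> [/nbhs_ballP [e /= /gt0_complexP [r r0 ->] h]|[r r0 h]].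
  by exists r => // y yr; apply: h; rewrite ball_rnorm.
apply/nbhs_ballP; exists r%:C; first by rewrite /= ltr0C.
by move=> y; rewrite ball_rnorm => /h.
Qed.

Lemma closure_rnormP (M : set V) x :
  closure M x <-> forall r : R, 0 < r -> exists2 y, M y & rnorm (x - y) < r.
Proof.
split=> [h r r0|h B /nbhs_rnormP [r r0 hB]].
  have [|y []] := h [set y | rnorm (x - y) < r]; last by exists y.
  by apply/nbhs_rnormP; exists r.
by have [y My yr] := h r r0; exists y; split => //; exact: hB.
Qed.

End RealNorm.

(** * Completeness and separability of l2 *)

Section L2Complete.
Variable R : realType.
Implicit Types (x y : l2 R).

Lemma rnorm_l2 x : rnorm x ^+ 2 = l2_sq x.
Proof. by apply: complexI; rewrite rmorphXn /= rnormE l2_normE. Qed.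

Lemma l2_coord_norm x k : sqmod (x k) <= rnorm x ^+ 2.
Proof. by rewrite rnorm_l2 l2_coord_le. Qed.

Lemma sqsummable_bounded (u : nat -> R[i]) (B : R) :
  (forall n, series (fun k => sqmod (u k)) n <= B) -> sqsummable u.
Proof.
move=> h; apply: nondecreasing_is_cvgn.
  by apply: nondecreasing_series => k _ _; exact: sqmod_ge0.
by exists B => _ [n _ <-].
Qed.

Lemma l2_sq_le x (B : R) :
  (forall n, series (fun k => sqmod (x k)) n <= B) -> l2_sq x <= B.
Proof.
move=> h; apply: limr_le; first exact: l2_sqsummable.
by near=> n; exact: h.
Unshelve. all: by end_near. Qed.

Section CauchyFilter.
Variables (F : set_system (l2 R)) (FF : ProperFilter F) (cF : cauchy F).

Let small (r : R) : 0 < r -> exists x, F [set y | rnorm (x - y) < r].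
Proof.
move=> r0; have /cauchyP cF' := cF.
have [|x Fx] := cF' r%:C; first by rewrite ltr0C.
by exists x; apply: filterS Fx => y; rewrite ball_rnorm.
Qed.

Let component_cvg (p : R[i] -> R) k :
  (forall z w, p (z - w) = p z - p w) -> (forall z, p z ^+ 2 <= sqmod z) ->
  cvg ((fun y : l2 R => p (y k)) @ F).
Proof.
move=> pB p2; apply: cauchy_cvg; apply/cauchyP => e e0.
have [x Fx] := small e0; exists (p (x k)); rewrite nbhs_simpl /=.
apply: filterS Fx => y /= yr; rewrite /ball /= -pB -(@ltr_pXn2r _ 2) //;
  rewrite ?nnegrE ?ltW //.
rewrite real_normK ?num_real //; apply: le_lt_trans (p2 _) _.
apply: le_lt_trans (l2_coord_norm (x - y) k) _.
by rewrite ltr_pXn2r ?nnegrE ?rnorm_ge0 // ltW.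
Qed.

Let l k : R[i] := lim ((fun y : l2 R => complex.Re (y k)) @ F) +i*
                  lim ((fun y : l2 R => complex.Im (y k)) @ F).

Let cvg_Re k : (fun y : l2 R => complex.Re (y k)) @ F --> complex.Re (l k).
Proof.
apply: (component_cvg (p := @complex.Re R)) => [z w|z]; first by rewrite raddfB.
by rewrite lerDl sqr_ge0.
Qed.

Let cvg_Im k : (fun y : l2 R => complex.Im (y k)) @ F --> complex.Im (l k).
Proof.
apply: (component_cvg (p := @complex.Im R)) => [z w|z]; first by rewrite raddfB.
by rewrite lerDr sqr_ge0.
Qed.

(** Bounds that hold for a Cauchy-close y survive in each finite partial sum
    when y tends to the coefficientwise limit l. *)
Let partial_le x (r : R) n : F [set y | rnorm (x - y) < r] ->
  series (fun k => sqmod (x k - l k)) n <= r ^+ 2.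
Proof.
move=> Fx.
have cv : (fun y : l2 R => series (fun k => sqmod (x k - y k)) n) @ F -->
          series (fun k => sqmod (x k - l k)) n.
  elim: n => [|n ih].
    by rewrite /series /= big_nil; under eq_fun do rewrite big_nil; exact: cvg_cst.
  rewrite seriesSr; under eq_fun do rewrite seriesSr.
  have cR : (fun y : l2 R => complex.Re (x n - y n)) @ F -->
            complex.Re (x n - l n).
    rewrite raddfB; under eq_fun do rewrite raddfB.
    by apply: cvgB; [exact: cvg_cst|exact: cvg_Re].
  have cI : (fun y : l2 R => complex.Im (x n - y n)) @ F -->
            complex.Im (x n - l n).
    rewrite raddfB; under eq_fun do rewrite raddfB.
    by apply: cvgB; [exact: cvg_cst|exact: cvg_Im].
  exact: cvgD ih (cvgD (cvgM cR cR) (cvgM cI cI)).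
apply: (cvgr_to_le cv).
apply: filterS Fx => y /= yr; apply: le_trans (l2_partial_le (x - y) n) _.
rewrite -rnorm_l2 ler_pXn2r ?nnegrE ?rnorm_ge0 ?ltW //.
exact: le_lt_trans (rnorm_ge0 _) yr.
Qed.

(** The limit is taken coefficient by coefficient.  A Cauchy bound on the
    partial sums of x - y passes to the limit in y, which gives both the
    square summability of the limit and the convergence in norm. *)
Lemma l2_cauchy_cvg : cvg F.
Proof.
have [x0 Fx0] := small ltr01.
have sxl : sqsummable (fun k => x0 k - l k).
  by apply: sqsummable_bounded => n; exact: partial_le Fx0.
pose L : l2 R := x0 - mkl2 sxl.
have LE k : L k = l k by rewrite /L l2B /= subKr.
apply/cvg_ex; exists L; move=> A /nbhs_rnormP [r r0 hA]; rewrite nbhs_simpl.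
have r2 : 0 < r / 2 by rewrite divr_gt0.
have [x Fx] := small r2.
have xL : rnorm (x - L) <= r / 2.
  rewrite -(@ler_pXn2r _ 2) ?nnegrE ?rnorm_ge0 ?(ltW r2) // rnorm_l2.
  apply: l2_sq_le => n; have := partial_le n Fx.
  by under eq_fun do rewrite -LE -l2B.
apply: filterS Fx => y /= yr; apply: hA.
apply: le_lt_trans (rnorm_triangle x _ _) _; rewrite rnormB.
by rewrite [ltRHS](splitr r) ler_ltD.
Qed.

End CauchyFilter.

HB.instance Definition _ := Uniform_isComplete.Build (l2 R) l2_cauchy_cvg.

Lemma l2_inner_norm x : `|x| ^+ 2 = (@l2_dot R : {dot l2 R for (@Num.conj R[i])}) x x.
Proof. by rewrite l2_normE -l2_dotE. Qed.

Definition l2_hilbert : hilbertSpace R := HilbertSpace l2_inner_norm.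

End L2Complete.
Section L2Theory.
Variable R : realType.
Local Notation H := (l2_hilbert R).
Implicit Types (x y : H).

(** The terms of index less than N are absorbed in a larger constant. *)
Lemma sqsummable_geometric (u : nat -> R[i]) (B : R) N :
  (forall k, (N <= k)%N -> sqmod (u k) <= B * 2^-1 ^+ k) -> sqsummable u.
Proof.
move=> h; pose B' := `|B| + \sum_(i < N) sqmod (u i) * 2 ^+ i.
have s0 : 0 <= \sum_(i < N) sqmod (u i) * 2 ^+ i.
  by apply: sumr_ge0 => i _; rewrite mulr_ge0 ?sqmod_ge0 // exprn_ge0.
apply: (sqsummable_le (w := geometric B' 2^-1)); last first.
  by apply: is_cvg_geometric_series; rewrite ger0_norm // invf_lt1 // ltr1n.
move=> k /=; have [Nk|kN] := leqP N k.
  apply: le_trans (h k Nk) _; rewrite ler_wpM2r ?exprn_ge0 //.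
  by apply: le_trans (ler_norm _) _; rewrite lerDl.
rewrite exprVn ler_pdivlMr ?exprn_gt0 // /B' (bigD1 (Ordinal kN)) //=.
apply: le_trans (_ : _ <= `|B| + sqmod (u k) * 2 ^+ k + 0) _.
  by rewrite addr0 lerDr.
rewrite addrA lerD2l sumr_ge0 // => i _.
by rewrite mulr_ge0 ?sqmod_ge0 // exprn_ge0.
Qed.

Lemma sqsummable_decay (u : nat -> R[i]) (e : R) : sqsummable u -> 0 < e ->
  exists N, forall k, (N <= k)%N -> sqmod (u k) < e.
Proof.
move=> su e0; have /cvg_series_cvg_0 c := su.
have /cvgrPdist_lt /(_ e e0) [N _ h] := c.
exists N => k Nk; have := h k Nk; rewrite /= sub0r normrN.
by apply: le_lt_trans; exact: ler_norm.
Qed.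

Lemma csum_single (u : nat -> R[i]) j : (forall k, k != j -> u k = 0) -> csum u = u j.
Proof.
move=> h.
have s (p : {additive R[i] -> R}) : limn (series (fun k => p (u k))) = p (u j).
  apply: lim_near_cst => //; near=> n; have jn : (j < n)%N by near: n; exists j.+1.
  rewrite seriesEord /= (bigD1 (Ordinal jn)) //= big1 ?addr0 // => i ij.
  by rewrite h ?raddf0 //; apply: contra_neq ij => ij; apply: val_inj.
by rewrite /csum !s; case: (u j).
Unshelve. all: by end_near. Qed.

Lemma sqsummable_delta (j : nat) :
  sqsummable (fun k => (k == j)%:R : R[i]).
Proof.
apply: (@sqsummable_geometric _ 0 j.+1) => k jk.
by rewrite gtn_eqF // /sqmod /= expr0n addr0 mul0r.
Qed.

Arguments sqsummable_delta : clear implicits.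

Definition l2_delta j : H := mkl2 (sqsummable_delta j).

Lemma inner_deltar x j : inner x (l2_delta j) = x j.
Proof.
rewrite /inner /= /l2_dot (@csum_single _ j) => [|k kj] /=.
  by rewrite eqxx rmorph1 mulr1.
by rewrite (negPf kj) rmorph0 mulr0.
Qed.

Lemma rat_approx (z : R[i]) (e : R) : 0 < e ->
  exists q : rat * rat, sqmod (z - (ratr q.1 +i* ratr q.2)) < e.
Proof.
move=> e0; pose d := Num.min 1 (e / 2).
have d0 : 0 < d by rewrite lt_min ltr01 divr_gt0.
have ap (t : R) : exists q : rat, (t - ratr q) ^+ 2 < e / 2.
  have /rat_in_itvoo [q] : t - d < t + d by lra.
  rewrite in_itv /= => /andP[q1 q2]; exists q.
  have h : `|t - ratr q| < d by rewrite ltr_norml; apply/andP; split; lra.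
  rewrite -[X in X < _]real_normK ?num_real //.
  have h0 := normr_ge0 (t - ratr q).
  have d1 : d <= 1 by rewrite ge_min lexx.
  have d2 : d <= e / 2 by rewrite ge_min lexx orbT.
  by nra.
case: z => a b; have [p hp] := ap a; have [q hq] := ap b.
by exists (p, q); rewrite /sqmod /=; lra.
Qed.

Lemma sqsummable_nth (s : seq (rat * rat)) :
  sqsummable (fun k => nth (0 : R[i]) [seq ratr q.1 +i* ratr q.2 | q <- s] k).
Proof.
apply: (@sqsummable_geometric _ 0 (size s)) => k sk.
by rewrite nth_default ?size_map // /sqmod /= expr0n addr0 mul0r.
Qed.

Arguments sqsummable_nth : clear implicits.

(** Finitely supported sequences of Gaussian rationals are dense: cut x off
    at N so that the tail is small, then approximate the first N
    coefficients. *)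
Lemma l2_separable : separable H.
Proof.
exists (range (fun s => mkl2 (sqsummable_nth s) : H)); split.
  exact: card_le_trans (card_image_le _ _) (countableP _).
move=> O [x Ox] oO; have : nbhs x O by exact: open_nbhs_nbhs.
move=> /nbhs_rnormP [e e0 h].
have e2 : 0 < e ^+ 2 / 2 by rewrite divr_gt0 // exprn_gt0.
have [N hN] : exists N, l2_sq x - series (fun k => sqmod (x k)) N < e ^+ 2 / 2.
  have /cvgrPdist_lt /(_ _ e2) [N _ hN] := @l2_sqsummable _ x.
  exists N; have := hN N (leqnn N); apply: le_lt_trans; exact: ler_norm.
pose d := (e ^+ 2 / 2) / N.+1%:R.
have d0 : 0 < d by rewrite divr_gt0.
have /choice [g hg] : forall k, exists q : rat * rat,
  sqmod (x k - (ratr q.1 +i* ratr q.2)) < d by move=> k; exact: rat_approx.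
have [y yS yE] : exists2 y : H,
    range (fun s => mkl2 (sqsummable_nth s) : H) y &
    forall k, y k = if (k < N)%N then ratr (g k).1 +i* ratr (g k).2 else 0.
  exists (mkl2 (sqsummable_nth (mkseq g N))); first by exists (mkseq g N).
  move=> k /=; case: ltnP => kN; last by rewrite nth_default ?size_map ?size_iota.
  by rewrite (nth_map (0, 0)) ?size_mkseq // nth_mkseq.
exists y; split=> //.
apply: h; rewrite -(@ltr_pXn2r _ 2) ?nnegrE ?rnorm_ge0 ?(ltW e0) // rnorm_l2.
have xd : \sum_(0 <= k < N) sqmod (x k - y k) <= N%:R * d.
  apply: le_trans (ler_sum_nat (G := fun=> d) _) _.
    by move=> k /andP[_ kN]; rewrite yE kN ltW.
  by rewrite sumr_const_nat subn0 mulr_natl.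
apply: (@le_lt_trans _ _ (N%:R * d + (l2_sq x - series (fun k => sqmod (x k)) N))).
  apply: l2_sq_le => n; apply: (@le_trans _ _
      (series (fun k => sqmod ((x - y) k)) (N + n)%N)).
    by apply: nondecreasing_series (leq_addl _ _) => k _ _; exact: sqmod_ge0.
  rewrite seriesEnat /= (@big_cat_nat _ _ _ N) ?leq_addr //=; apply: lerD => //.
  rewrite lerBrDl.
  apply: le_trans (l2_partial_le x (N + n)).
  rewrite !seriesEnat /= [leRHS](@big_cat_nat _ _ _ N) ?leq_addr //= lerD2l.
  apply: ler_sum_nat => k /andP[Nk _].
  suff : sqmod (x k - y k) <= sqmod (x k) by [].
  by rewrite yE ltnNge Nk /= subr0.
suff : N%:R * d <= e ^+ 2 / 2 by lra.
by rewrite /d mulrC mulrAC ler_pdivrMr // ler_pM2l // ler_nat.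
Qed.

End L2Theory.
(** * Hilbert spaces: inner product, projection, density *)

Section HilbertTheory.
Variables (R : realType) (H : hilbertSpace R).
Implicit Types (x y z u v : H) (a : R[i]) (M : set H) (T : set (H * H)).

Lemma innerC x y : inner x y = Num.conj (inner y x).
Proof. by rewrite (hermC inner) mul1r. Qed.

Lemma innerDl x y z : inner (x + y) z = inner x z + inner y z.
Proof. exact: linearDl. Qed.

Lemma innerBl x y z : inner (x - y) z = inner x z - inner y z.
Proof. exact: linearBl. Qed.

Lemma innerZl a x z : inner (a *: x) z = a * inner x z.
Proof. by rewrite linearZl_LR. Qed.

Lemma innerDr x y z : inner z (x + y) = inner z x + inner z y.
Proof. exact: linearDr. Qed.

Lemma innerBr x y z : inner z (x - y) = inner z x - inner z y.
Proof. exact: linearBr. Qed.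

Lemma innerZr a x z : inner z (a *: x) = Num.conj a * inner z x.
Proof. by rewrite linearZr_LR. Qed.

Lemma conj_real (r : R) : Num.conj r%:C = r%:C :> R[i].
Proof. exact: conjc_real. Qed.

Lemma innerZr_real (r : R) x z : inner z (r%:C *: x) = r%:C * inner z x.
Proof. by rewrite innerZr conj_real. Qed.

Lemma inner0l x : inner 0 x = 0. Proof. exact: linear0l. Qed.
Lemma inner0r x : inner x 0 = 0. Proof. exact: linear0r. Qed.

Lemma inner_rnorm x : inner x x = (rnorm x ^+ 2)%:C.
Proof. by rewrite -inner_norm -rnormE rmorphXn. Qed.

Lemma inner_eq0 x : inner x x = 0 -> x = 0.
Proof.
rewrite inner_rnorm => /complexI /eqP.
by rewrite sqrf_eq0 => /eqP /rnorm_eq0.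
Qed.

Lemma rnorm_sqD x y :
  rnorm (x + y) ^+ 2 =
  rnorm x ^+ 2 + rnorm y ^+ 2 + 2 * complex.Re (inner x y).
Proof.
have := inner_rnorm (x + y).
rewrite innerDl !innerDr (innerC y x) !inner_rnorm.
case: (inner x y) => p q /= [<- _]; ring.
Qed.

Lemma rnorm_sqB x y :
  rnorm (x - y) ^+ 2 =
  rnorm x ^+ 2 + rnorm y ^+ 2 - 2 * complex.Re (inner x y).
Proof.
rewrite rnorm_sqD rnormN -scaleN1r innerZr rmorphN rmorph1 mulN1r.
by case: (inner x y) => p q /=; rewrite mulrN.
Qed.

Lemma pythagoras x y : inner x y = 0 ->
  rnorm (x + y) ^+ 2 = rnorm x ^+ 2 + rnorm y ^+ 2.
Proof. by move=> xy; rewrite rnorm_sqD xy mulr0 addr0. Qed.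

Lemma parallelogram x y :
  rnorm (x + y) ^+ 2 + rnorm (x - y) ^+ 2 =
  2 * rnorm x ^+ 2 + 2 * rnorm y ^+ 2.
Proof. rewrite rnorm_sqD rnorm_sqB; ring. Qed.

Lemma CauchySchwarz_rnorm x y :
  complex.Re `|inner x y| <= rnorm x * rnorm y.
Proof.
have := dot_CauchySchwarz inner x y.
have /complex_realP [r e] := normr_real (inner x y); rewrite e /=.
rewrite !inner_rnorm -rmorphM /= -exprMn.
have r0 : 0 <= r by rewrite -ler0c -e.
by rewrite -rmorphXn lecR ler_pXn2r ?nnegrE ?mulr_ge0 ?rnorm_ge0.
Qed.

Lemma rnorm_scaleR (r : R) x : rnorm (r%:C *: x) = `|r| * rnorm x.
Proof. by rewrite rnormZ normc_def /= expr0n addr0 sqrtr_sqr. Qed.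

(** Each condition defining the adjoint is an equality between functions of
    the pair that are continuous by the Cauchy-Schwarz inequality. *)
Lemma closed_adjoint T : closed (adjoint T).
Proof.
move=> [x y] cxy u v Tuv /=.
apply/eqP; rewrite -subr_eq0 -normr_eq0.
suff le0 (e : R) : 0 < e ->
    complex.Re `|inner v x - inner u y| <= e * (rnorm v + rnorm u).
  have /complex_realP [r er] := normr_real (inner v x - inner u y).
  have r0 : 0 <= r by rewrite -ler0c -er.
  rewrite er; suff -> : r = 0 by [].
  apply/le_anti; rewrite r0 andbT; apply/ler_addgt0Pr => e e0; rewrite add0r.
  have s0 : 0 < rnorm v + rnorm u + 1.
    by rewrite ltr_wpDl ?addr_ge0 ?rnorm_ge0.
  have := le0 _ (divr_gt0 e0 s0); rewrite er /= => /le_trans; apply.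
  rewrite mulrAC ler_pdivrMr // ler_pM2l //; lra.
move=> e0.
have [] := cxy ([set z | rnorm (x - z) < e] `*` [set z | rnorm (y - z) < e]).
  exists ([set z | rnorm (x - z) < e], [set z | rnorm (y - z) < e]) => //=.
  by split; apply/nbhs_rnormP; exists e.
move=> [x' y'] [/= /(_ u v Tuv) /= E [xx' yy']].
have -> : inner v x - inner u y = inner v (x - x') - inner u (y - y').
  by rewrite !innerBr E; ring.
have tri (z w : R[i]) : complex.Re `|z - w| <= complex.Re `|z| + complex.Re `|w|.
  have := ler_normB z w; rewrite lecE => /andP[_]; by rewrite raddfD.
apply: le_trans (tri _ _) _; rewrite mulrDr; apply: lerD;
  apply: le_trans (CauchySchwarz_rnorm _ _) _; rewrite mulrC;
  by rewrite ler_wpM2r ?rnorm_ge0 // ltW.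
Qed.

Lemma subspaceD M x y : Defs.subspace M -> M x -> M y -> M (x + y).
Proof. by move=> [_ sM] Mx My; have := sM 1 x y Mx My; rewrite scale1r. Qed.

Lemma subspaceZ M a x : Defs.subspace M -> M x -> M (a *: x).
Proof. by move=> [M0 sM] Mx; have := sM a x 0 Mx M0; rewrite addr0. Qed.

Section Projection.
Variables (M : set H) (sM : Defs.subspace M) (cM : closed M) (x : H).

Let D : set R := [set rnorm (x - m) ^+ 2 | m in M].

Let infD : has_inf D.
Proof.
split; first by exists (rnorm (x - 0) ^+ 2), 0 => //; exact: sM.1.
by exists 0 => _ [m _ <-]; exact: sqr_ge0.
Qed.

Let dist_le m : M m -> inf D <= rnorm (x - m) ^+ 2.
Proof. by move=> Mm; apply: ge_inf; [exact: infD.2|exists m]. Qed.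

(** By the parallelogram law, near-minimizers of the distance from x to M are
    close to each other, because their midpoint is in M as well. *)
Let near_min (e : R) m m' : M m -> M m' ->
  rnorm (x - m) ^+ 2 < inf D + e -> rnorm (x - m') ^+ 2 < inf D + e ->
  rnorm (m - m') ^+ 2 <= 4 * e.
Proof.
move=> Mm Mm' dm dm'.
have := parallelogram (x - m') (x - m).
have -> : x - m' - (x - m) = m - m' by rewrite opprB addrC addrA subrK.
have -> : x - m' + (x - m) = 2%:C *: (x - 2^-1%:C *: (m + m')).
  rewrite scalerBr scalerA -rmorphM mulfV //= scale1r.
  rewrite (_ : 2%:C = 1 + 1) ?scalerDl ?scale1r; last first.
    by apply/eqP; rewrite eq_complex /= addr0 !eqxx.
  by rewrite addrACA -opprD (addrC m').
rewrite rnorm_scaleR exprMn ger0_norm //.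
have : inf D <= rnorm (x - 2^-1%:C *: (m + m')) ^+ 2.
  by apply: dist_le; apply: subspaceZ => //; exact: subspaceD.
rewrite (_ : 2 ^+ 2 = 4 :> R); [lra|ring].
Qed.

(** The projection theorem: a minimizing sequence is Cauchy, its limit q
    realizes the distance to M, and by minimality x - q has no component along
    any vector of M. *)
Lemma orthogonal_projection :
  exists2 q, M q & orthogonal_complement M (x - q).
Proof.
have /choice [m hm] : forall n : nat, exists m,
    M m /\ rnorm (x - m) ^+ 2 < inf D + n.+1%:R^-1.
  move=> n; have [] := @inf_adherent _ D n.+1%:R^-1 _ infD.
    by rewrite invr_gt0.
  by move=> _ [m Mm <-] h; exists m.
have close N n : (N <= n)%N -> rnorm (m N - m n) ^+ 2 <= 4 * N.+1%:R^-1.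
  move=> Nn; apply: near_min (hm N).1 (hm n).1 (hm N).2 _.
  apply: lt_le_trans (hm n).2 _; rewrite lerD2l lef_pV2 ?posrE //.
  by rewrite ler_nat.
have small (r : R) : 0 < r -> exists N, forall n, (N <= n)%N -> rnorm (m N - m n) < r.
  move=> r0; have r2 : 0 < r ^+ 2 / 4 by rewrite divr_gt0 // exprn_gt0.
  have /cvgrPdist_lt /(_ _ r2) [N _ /(_ N (leqnn N))] := @cvg_harmonic R.
  rewrite /= sub0r normrN ger0_norm ?invr_ge0 // => hN.
  exists N => n Nn; rewrite -(@ltr_pXn2r _ 2) ?nnegrE ?rnorm_ge0 ?(ltW r0) //.
  by apply: le_lt_trans (close _ _ Nn) _; rewrite mulrC -ltr_pdivlMr.
have [q mq] : exists q, forall r : R, 0 < r ->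
    exists N, forall n, (N <= n)%N -> rnorm (q - m n) < r.
  have : cauchy (m @ \oo).
    apply/cauchyP => e /gt0_complexP [r r0 ->].
    have [N hN] := small r r0; exists (m N); exists N => // n Nn /=.
    by rewrite ball_rnorm; exact: hN.
  move/cauchy_cvg => /cvg_ex [q mq]; exists q => r r0.
  have [|N _ hN] := mq [set y | rnorm (q - y) < r].
    by apply/nbhs_rnormP; exists r.
  by exists N => n; exact: hN.
have Mq : M q.
  apply: cM; apply/closure_rnormP => r r0.
  by have [N hN] := mq r r0; exists (m N); [exact: (hm N).1|exact: hN].
have qmin : rnorm (x - q) ^+ 2 <= inf D.
  rewrite leNgt; apply/negP; set A := rnorm (x - q) => lt.
  have A0 : 0 <= A by exact: rnorm_ge0.
  have d0 : 0 <= inf D by apply: lb_le_inf infD.1 _ => _ [y _ <-]; exact: sqr_ge0.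
  pose t := A ^+ 2 - inf D; have t0 : 0 < t by rewrite subr_gt0.
  have A4 : 0 < 4 * A + 4 by rewrite ltr_wpDl // mulr_ge0.
  have [N hN] := mq (t / (4 * A + 4)) (divr_gt0 t0 A4).
  have t2 : 0 < t / 2 by rewrite divr_gt0.
  have /cvgrPdist_lt /(_ _ t2) [N' _ /(_ (N + N')%N (leq_addl _ _))] :=
    @cvg_harmonic R.
  rewrite /= sub0r normrN ger0_norm ?invr_ge0 // => hN'.
  have := (hm (N + N')%N).2; have := hN (N + N')%N (leq_addr _ _).
  have := rnorm_triangle (m (N + N')%N) x q; rewrite -/A (rnormB (m _) q).
  set b := rnorm (x - _); set s := rnorm (q - _) => h1 h2 h3.
  have b0 : 0 <= b by exact: rnorm_ge0.
  have h2' : s * (4 * A + 4) < t.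
    by rewrite -ltr_pdivlMr // ltr_wpDl // mulr_ge0.
  have s0 : 0 <= s by exact: rnorm_ge0.
  have tA : t <= A ^+ 2 by rewrite /t; lra.
  have As : s <= A by nra.
  have : (A - s) ^+ 2 <= b ^+ 2.
    by rewrite ler_pXn2r ?nnegrE ?subr_ge0 // lerBlDr.
  have : t = A ^+ 2 - inf D by [].
  have : 0 <= s ^+ 2 by exact: sqr_ge0.
  move: hN' h3 h2'; set w := _.+1%:R^-1; clearbody w t.
  by rewrite sqrrB mulrDr (_ : s * (4 * A) = 4 * (A * s)); [lra|ring].
exists q => // z Mz; have [->|z0] := eqVneq z 0; first exact: inner0l.
pose f := x - q; pose t := inner f z / inner z z.
have zz : inner z z != 0 by apply: contra_neq z0; exact: inner_eq0.
have ort : inner (f - t *: z) (t *: z) = 0.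
  by rewrite innerZr innerBl innerZl /t divfK // subrr mulr0.
have := pythagoras ort; rewrite subrK => E.
have le : rnorm f ^+ 2 <= rnorm (f - t *: z) ^+ 2.
  apply: le_trans qmin _; rewrite /f -addrA -opprD; apply: dist_le.
  by apply: subspaceD => //; exact: subspaceZ.
have : t *: z = 0.
  apply: rnorm_eq0; apply/eqP; rewrite -sqrf_eq0; apply/eqP/le_anti.
  by rewrite sqr_ge0 andbT; lra.
move/eqP; rewrite scaler_eq0 (negPf z0) orbF /t mulf_eq0 invr_eq0 (negPf zz) orbF.
by move/eqP => fz; rewrite innerC fz rmorph0.
Qed.

End Projection.

Lemma subspace_closure M : Defs.subspace M -> Defs.subspace (closure M).
Proof.
move=> sM; split; first by apply: subset_closure; exact: sM.1.
move=> a x y /closure_rnormP cx /closure_rnormP cy; apply/closure_rnormP => r r0.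
set K := complex.Re `|a|.
have K0 : 0 <= K.
  by rewrite /K; have /complex_realP [s e] := normr_real a; rewrite e /= -ler0c -e.
have K1 : 0 < 2 * (K + 1) by rewrite mulr_gt0 // ltr_wpDl.
have [x' Mx' hx] := cx _ (divr_gt0 r0 K1).
have [y' My' hy] := cy _ (divr_gt0 r0 (ltr0n R 2)).
exists (a *: x' + y'); first exact: sM.2.
have -> : a *: x + y - (a *: x' + y') = a *: (x - x') + (y - y').
  by rewrite scalerBr opprD addrACA.
apply: le_lt_trans (rnormD _ _) _; rewrite rnormZ -/K.
move: hx; rewrite ltr_pdivlMr // => hx.
have := rnorm_ge0 (x - x'); nra.
Qed.

(** Project to the closure of M: the remainder is orthogonal to M, hence 0. *)
Lemma dense_orthogonal M : Defs.subspace M ->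
  (forall y, orthogonal_complement M y -> y = 0) -> dense M.
Proof.
move=> sM h O [x Ox] oO.
have [q cq oq] := orthogonal_projection (subspace_closure sM) (@closed_closure _ M) x.
have /eqP : x - q = 0.
  by apply: h => m Mm; apply: oq; exact: subset_closure.
rewrite subr_eq0 => /eqP xq; rewrite -xq in cq.
by rewrite setIC; apply: cq; exact: open_nbhs_nbhs.
Qed.

End HilbertTheory.
(** * Spectrum of a self-adjoint operator near an approximate eigenvector *)

Section SelfAdjointSpectrum.
Variables (R : realType) (H : hilbertSpace R) (T : set (H * H)).
Implicit Types (x y z u v : H).

Lemma operator_combination (a : R[i]) x y x' y' : operator T ->
  T (x, y) -> T (x', y') -> T (a *: x + x', a *: y + y').
Proof. by move=> [[_ sT] _] Tx Tx'; exact: (sT a (x, y) (x', y') Tx Tx'). Qed.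

(** Makes the complex constant in the definition of the resolvent set a
    positive real one. *)
Lemma resolvent_bound (z : R[i]) : resolvent_set T z ->
  exists2 K : R, 0 < K & forall x y, T (x, y) -> rnorm x <= K * rnorm (y - z *: x).
Proof.
move=> [_ _ [c hc]]; exists (`|complex.Re c| + 1).
  by rewrite ltr_wpDl.
move=> x y Txy; have := hc x y Txy.
rewrite -!rnormE; case: c hc => p q _; rewrite lecE /= => /andP[_].
rewrite mulr0 subr0 => /le_trans; apply; rewrite ler_wpM2r ?rnorm_ge0 //.
by apply: le_trans (ler_norm p) _; rewrite lerDl.
Qed.

Hypothesis saT : selfadjoint T.

Lemma selfadjoint_symmetric : symmetric_operator T.
Proof.
move=> x y u v Txy Tuv; have [_ _ E] := saT.
have A : adjoint T (u, v) by rewrite -E.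
exact: A _ _ Txy.
Qed.

(** Suppose that [c - e, c + e] avoids the spectrum and let S be the inverse of
    T - c.  The supremum r2 of |S w|^2 / |w|^2 is at least 1 / e^2.  For w almost
    realizing it, |S^2 w - r2 w| is small, since
    |S^2 w - r2 w|^2 <= r2 (r2 |w|^2 - |S w|^2).  But with d = 1 / sqrt r2 <= e,
    the vector S^2 w - r2 w is -r2 (T - c - d) (T - c + d) S^2 w, and both
    factors are bounded below because c + d and c - d are in the resolvent set;
    so S^2 w, hence r2 w, would be small compared to r2 w. *)
Theorem selfadjoint_spectrum_near (c e : R) u v :
  T (u, v) -> u != 0 -> rnorm (v - c%:C *: u) <= e * rnorm u ->
  exists2 l : R, `|l - c| <= e & spectrum T l%:C.
Proof.
move=> Tuv u0 uve; apply: contrapT => noS.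
have [opT _ _] := saT; have sym := selfadjoint_symmetric.
have res l : `|l - c| <= e -> resolvent_set T l%:C.
  by move=> lc; apply: contrapT => h; apply: noS; exists l.
have un : 0 < rnorm u by exact: rnorm_gt0.
have e0 : 0 <= e.
  by rewrite -(@pmulr_lge0 _ (rnorm u)) //; exact: le_trans (rnorm_ge0 _) uve.
have resc : resolvent_set T c%:C by apply: res; rewrite subrr normr0.
have [K K0 hK] := resolvent_bound resc.
have [_ ranc _] := resc.
pose W x y := rnorm (y - c%:C *: x).
pose Q : set R := [set r | exists x y, [/\ T (x, y), 0 < W x y &
                                       r = rnorm x ^+ 2 / W x y ^+ 2]].
have Wuv : 0 < W u v.
  by rewrite -(@pmulr_rgt0 _ K) //; apply: lt_le_trans un (hK _ _ Tuv).
have Quv : Q (rnorm u ^+ 2 / W u v ^+ 2) by exists u, v.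
have hQ : has_sup Q.
  split; first by eexists; exact: Quv.
  exists (K ^+ 2) => _ [x [y [Txy Wxy ->]]].
  rewrite ler_pdivrMr ?exprn_gt0 // -exprMn.
  by rewrite ler_pXn2r ?nnegrE ?mulr_ge0 ?rnorm_ge0 ?(ltW K0) // hK.
set r2 := sup Q.
have leQ x y : T (x, y) -> rnorm x ^+ 2 <= r2 * W x y ^+ 2.
  move=> Txy; have := rnorm_ge0 (y - c%:C *: x).
  rewrite -/(W x y) le_eqVlt => /predU1P[W0|Wgt].
    have := hK _ _ Txy; rewrite -/(W x y) -W0 mulr0 => xn.
    have -> : rnorm x = 0 by apply/le_anti; rewrite xn rnorm_ge0.
    by rewrite !expr0n /= mulr0.
  rewrite -ler_pdivrMr ?exprn_gt0 //.
  by apply: sup_upper_bound => //; exists x, y.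
have r2u : rnorm u ^+ 2 / W u v ^+ 2 <= r2 by exact: sup_upper_bound.
have r20 : 0 < r2.
  by apply: lt_le_trans r2u; rewrite divr_gt0 // exprn_gt0.
pose d := Num.sqrt r2^-1.
have d0 : 0 <= d by exact: sqrtr_ge0.
have dd : d ^+ 2 * r2 = 1.
  by rewrite /d sqr_sqrtr ?invr_ge0 ?ltW // mulVf // gt_eqF.
have de : d <= e.
  rewrite -(@ler_pXn2r _ 2) ?nnegrE // /d sqr_sqrtr ?invr_ge0 ?(ltW r20) //.
  rewrite -(@ler_pM2r _ r2) // mulVf ?gt_eqF //.
  have : 1 <= e ^+ 2 * (rnorm u ^+ 2 / W u v ^+ 2).
    rewrite mulrA ler_pdivlMr ?exprn_gt0 // mul1r -exprMn.
    by rewrite ler_pXn2r ?nnegrE ?mulr_ge0 ?rnorm_ge0.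
  by move=> /le_trans; apply; rewrite ler_wpM2l ?sqr_ge0.
have [K1 K10 hK1] : exists2 K : R, 0 < K & forall x y, T (x, y) ->
    rnorm x <= K * rnorm (y - (c + d)%:C *: x).
  by apply/resolvent_bound/res; rewrite addrAC subrr add0r ger0_norm.
have [K2 K20 hK2] : exists2 K : R, 0 < K & forall x y, T (x, y) ->
    rnorm x <= K * rnorm (y - (c - d)%:C *: x).
  apply/resolvent_bound/res; rewrite addrAC subrr add0r normrN ger0_norm //.
pose L := K2 * (K1 * d ^+ 2).
have L0 : 0 <= L by rewrite !mulr_ge0 ?sqr_ge0 // ltW.
(* any h with (L + 1)^2 h < 1 contradicts the last chain of inequalities *)
pose h := ((L + 1) ^+ 2)^-1 / 2.
have h0 : 0 < h by rewrite divr_gt0 // invr_gt0 exprn_gt0 // ltr_wpDl.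
have [_ [x [y [Txy Wxy ->]]]] := sup_adherent (mulr_gt0 r20 h0) hQ.
rewrite -/r2 ltr_pdivlMr ?exprn_gt0 // => xbig.
have [[x' y'] /= Tx' xE] : ran T c%:C x by rewrite ranc.
(* in terms of S: x is S w and x' is S^2 w *)
pose w := y - c%:C *: x.
have Ww : W x y = rnorm w by [].
pose g := rnorm (x' - r2%:C *: w).
have g2 : g ^+ 2 <= r2 ^+ 2 * h * rnorm w ^+ 2.
  have ip : inner x' w = (rnorm x ^+ 2)%:C.
    rewrite /w innerBr -(sym _ _ _ _ Tx' Txy) innerZr_real -innerZl -innerBl.
    by rewrite xE inner_rnorm.
  rewrite /g rnorm_sqB rnorm_scaleR (ger0_norm (ltW r20)) innerZr_real ip.
  rewrite -rmorphM /= exprMn.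
  have := leQ _ _ Tx'; rewrite /W xE; move: xbig; rewrite Ww.
  set X := rnorm x ^+ 2; set Wn := rnorm w ^+ 2; set X' := rnorm x' ^+ 2.
  move=> hb hX'; have := ler_wpM2l (ltW r20) (ltW hb); nra.
pose p := x + d%:C *: x'.
have Tp : T (p, y + d%:C *: y').
  by rewrite /p addrC (addrC y); exact: operator_combination.
have pE : (y + d%:C *: y') - (c + d)%:C *: p =
          - ((d ^+ 2)%:C *: (x' - r2%:C *: w)).
  have -> : y' = x + c%:C *: x' by rewrite -xE subrK.
  have -> : y = w + c%:C *: x by rewrite /w subrK.
  rewrite scalerBr scalerA -rmorphM /= dd scale1r.
  rewrite /p rmorphD scalerDl !scalerDr !scalerA expr2 rmorphM /=.
  rewrite (mulrC d%:C c%:C).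
  move: (c%:C *: x) (d%:C *: x) ((c%:C * d%:C) *: x') ((d%:C * d%:C) *: x').
  move=> s1 s2 s3 s4.
  apply/eqP; rewrite opprB subr_eq (addrA (s1 + s3)) [eqbRHS]addrACA.
  by rewrite addNr addr0 !addrA (addrAC _ s2).
have hp : rnorm p <= K1 * (d ^+ 2 * g).
  have := hK1 _ _ Tp; rewrite pE rnormN rnorm_scaleR ger0_norm ?sqr_ge0 //.
have hx' : rnorm x' <= L * g.
  have := hK2 _ _ Tx'.
  have -> : y' - (c - d)%:C *: x' = p.
    by rewrite /p rmorphB /= scalerBl opprB addrA addrAC xE.
  move=> /le_trans; apply.
  have -> : L * g = K2 * (K1 * (d ^+ 2 * g)) by rewrite /L !mulrA.
  by apply: ler_wpM2l; [exact: ltW|].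
have tri : r2 * rnorm w <= (L + 1) * g.
  have := rnorm_triangle x' (r2%:C *: w) 0; rewrite !subr0 rnorm_scaleR.
  rewrite (ger0_norm (ltW r20)) rnormB -/g => /le_trans; apply.
  by rewrite mulrDl mul1r addrC lerD2r.
have g0 : 0 <= g by exact: rnorm_ge0.
have wn : 0 < r2 * rnorm w by rewrite mulr_gt0 // -Ww.
have : (r2 * rnorm w) ^+ 2 <= ((L + 1) * g) ^+ 2.
  by rewrite ler_pXn2r ?nnegrE ?mulr_ge0 ?addr_ge0 ?(ltW r20) ?rnorm_ge0.
rewrite [leRHS]exprMn leNgt => /negP; apply.
apply: (@le_lt_trans _ _ ((L + 1) ^+ 2 * (r2 ^+ 2 * h * rnorm w ^+ 2))).
  by rewrite ler_wpM2l ?sqr_ge0.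
have -> : (L + 1) ^+ 2 * (r2 ^+ 2 * h * rnorm w ^+ 2) =
          (r2 * rnorm w) ^+ 2 / 2.
  by rewrite /h; field; rewrite gt_eqF // ltr_wpDl.
by rewrite ltr_pdivrMr // ltr_pMr ?exprn_gt0 // ltr1n.
Qed.

End SelfAdjointSpectrum.
(** * Subspaces attached to an operator *)

Section AdjointTheory.
Variables (R : realType) (H : hilbertSpace R).
Implicit Types (T : set (H * H)).

Lemma subspace_adjoint T : Defs.subspace (adjoint T).
Proof.
split=> [u v _|a [x y] [x' y'] h h' u v Tuv] /=.
  by rewrite !inner0r.
have /= E := h u v Tuv; have /= E' := h' u v Tuv.
by rewrite !innerDr !innerZr E E'.
Qed.

Lemma subspace_dom T : Defs.subspace T -> Defs.subspace (dom T).
Proof.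
move=> sT; split; first by exists 0; exact: sT.1.
move=> a x x' [y Txy] [y' Txy'].
by exists (a *: y + y'); exact: (sT.2 a (x, y) (x', y')).
Qed.

Lemma subspace_ker T z : Defs.subspace T -> Defs.subspace (ker T z).
Proof.
move=> sT; split; first by rewrite /ker /= scaler0; exact: sT.1.
move=> a x x' kx kx'; rewrite /ker /= scalerDr scalerA (mulrC z) -scalerA.
exact: (sT.2 a (x, z *: x) (x', z *: x')).
Qed.

Lemma subspace_ran T z : Defs.subspace T -> Defs.subspace (ran T z).
Proof.
move=> sT; split.
  by exists 0; [exact: sT.1|rewrite /= scaler0 subr0].
move=> a _ _ [p Tp <-] [p' Tp' <-]; exists (a *: p + p'); first exact: sT.2.
rewrite /= scalerDr opprD addrACA scalerBr !scalerA.
by rewrite (mulrC z).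
Qed.

Lemma subspace_sum (M : set H) (I : Type) (r : seq I) (c : I -> R[i]) (F : I -> H) :
  Defs.subspace M -> (forall i, M (F i)) -> M (\sum_(i <- r) c i *: F i).
Proof.
move=> sM MF; elim/big_rec: _ => [|i x _ Mx]; first exact: sM.1.
exact: sM.2.
Qed.

End AdjointTheory.

(** * Orthonormal bases *)

Section HilbertBasis.
Variables (R : realType) (H : hilbertSpace R).
Implicit Types (e : nat -> H) (x y : H).

Definition fourier e x k : R[i] := inner x (e k).

(** Parseval's identity and the Riesz-Fischer theorem are part of the notion,
    so that vectors can be handled as square summable sequences. *)
Definition hilbert_basis e :=
  [/\ forall j k, fourier e (e j) k = (k == j)%:R,
      forall x, sqsummable (fourier e x),
      forall x y, inner x y = csum (fun k => fourier e x k * Num.conj (fourier e y k))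
    & forall u, sqsummable u -> exists x, forall k, fourier e x k = u k].

Lemma fourierB e x y k : fourier e (x - y) k = fourier e x k - fourier e y k.
Proof. exact: innerBl. Qed.

Lemma fourierZ e (a : R[i]) x k : fourier e (a *: x) k = a * fourier e x k.
Proof. exact: innerZl. Qed.

Lemma fourier0 e k : fourier e 0 k = 0.
Proof. exact: inner0l. Qed.

Lemma fourier_sum e (I : Type) (r : seq I) (F : I -> H) k :
  fourier e (\sum_(i <- r) F i) k = \sum_(i <- r) fourier e (F i) k.
Proof.
by elim/big_rec2: _ => [|i s t _ <-]; [exact: inner0l|exact: innerDl].
Qed.

Lemma inner_basisl e x k : inner (e k) x = Num.conj (fourier e x k).
Proof. exact: innerC. Qed.

Section Basis.
Variables (e : nat -> H) (basis_e : hilbert_basis e).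

Lemma fourier_basis j k : fourier e (e j) k = (k == j)%:R.
Proof. by case: basis_e. Qed.

Lemma inner_disjoint x y :
  (forall k, fourier e x k * Num.conj (fourier e y k) = 0) -> inner x y = 0.
Proof.
have [_ _ parseval _] := basis_e.
by move=> h; rewrite parseval (@csum_single _ _ 0) => [|k _]; exact: h.
Qed.

Lemma fourier_eq0 x : (forall k, fourier e x k = 0) -> x = 0.
Proof.
move=> h; apply: inner_eq0; apply: inner_disjoint => k.
by rewrite h mul0r.
Qed.

Lemma fourier_inj x y : (forall k, fourier e x k = fourier e y k) -> x = y.
Proof.
move=> h; apply/eqP; rewrite -subr_eq0; apply/eqP/fourier_eq0 => k.
by rewrite fourierB h subrr.
Qed.

Lemma fourier_le_rnorm x k : sqmod (fourier e x k) <= rnorm x ^+ 2.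
Proof.
have := dot_CauchySchwarz inner x (e k).
rewrite -/(fourier e (e k) k) fourier_basis eqxx mulr1 inner_rnorm.
by rewrite -sqmodE lecR.
Qed.

End Basis.
End HilbertBasis.

Lemma l2_hilbert_basis (R : realType) : hilbert_basis (@l2_delta R).
Proof.
have cE x k : fourier (@l2_delta R) x k = x k by exact: inner_deltar.
split=> [j k|x|x y|u su].
- by rewrite cE.
- rewrite (_ : fourier _ x = x); first exact: l2_sqsummable.
  by apply/funext => k; exact: cE.
- by under eq_fun do rewrite !cE.
- by exists (mkl2 su : l2_hilbert R) => k; rewrite cE.
Qed.

(** * The restricted diagonal operator *)

Section DiagonalOperator.
Variables (R : realType) (H : hilbertSpace R) (e : nat -> H).
Variables (d : nat) (a phi : nat -> R).
Local Notation fourier := (fourier e).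
Implicit Types (x y u v : H) (k l : nat) (z : R[i]).

Hypothesis basis_e : hilbert_basis e.
Hypothesis d_gt0 : (0 < d)%N.
Hypothesis a_inj : injective a.
Hypothesis phi_gt0 : forall k, 0 < phi k.
Hypothesis phi_unbounded :
  forall i (C : R), (i < d)%N -> exists2 l, (l %% d = i)%N & C < phi l.
Hypothesis phi_resolvent :
  forall z, sqsummable (fun k => (phi k)%:C / (z - (a k)%:C)).

(** The adjoint of the restricted diagonal operator; c gives the constant
    attached to each colour. *)
Definition maximal_op : set (H * H) :=
  [set p : H * H | exists c : nat -> R[i], forall k,
    fourier p.2 k - (a k)%:C * fourier p.1 k = c (k %% d)%N * (phi k)%:C].

Definition minimal_op : set (H * H) := adjoint maximal_op.

Let phi_neq0 k : (phi k)%:C != 0 :> R[i].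
Proof. by rewrite gt_eqF // ltr0C. Qed.

(** Test against the pair (e_k, a_k e_k) of the maximal operator. *)
Lemma minimal_op_diag x y k :
  minimal_op (x, y) -> fourier y k = (a k)%:C * fourier x k.
Proof.
have B : maximal_op (e k, (a k)%:C *: e k).
  exists (fun=> 0) => j /=; rewrite fourierZ (fourier_basis basis_e) mul0r.
  by have [->|] := eqVneq j k; rewrite ?subrr // !mulr0 subr0.
move=> /(_ _ _ B) /=; rewrite innerZl !inner_basisl.
by move=> /(congr1 Num.conj); rewrite rmorphM /= !conjCK conj_real.
Qed.

Lemma minimal_op_maximal : minimal_op `<=` maximal_op.
Proof.
move=> [x y] Axy; exists (fun=> 0) => k /=.
by rewrite (minimal_op_diag _ Axy) subrr mul0r.
Qed.

(** The simplest vectors of the k, l coordinate plane that satisfy the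
    condition of the common colour of k and l. *)
Definition pair_vec k l : H :=
  (phi l)%:C *: e k - (phi k)%:C *: e l.

Definition pair_img k l : H :=
  (phi l * a k)%:C *: e k - (phi k * a l)%:C *: e l.

Lemma minimal_op_pair k l : (k %% d = l %% d)%N ->
  minimal_op (pair_vec k l, pair_img k l).
Proof.
move=> kl x y [c hc] /=.
rewrite /pair_vec /pair_img !innerBr !innerZr_real -!/(fourier _ _).
have Ek := hc k; have El := hc l; rewrite -kl /= in Ek El.
have -> : fourier y k = (a k)%:C * fourier x k + c (k %% d)%N * (phi k)%:C.
  by rewrite -Ek addrC subrK.
have -> : fourier y l = (a l)%:C * fourier x l + c (k %% d)%N * (phi l)%:C.
  by rewrite -El addrC subrK.
by rewrite !rmorphM /=; ring.
Qed.

(** If (x, y) is in the adjoint, testing against the pairs of indices k, l of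
    one colour shows that (y_k - a_k x_k) / phi_k takes the same value at l.
    The constant of a colour is read off at its residue k mod d, which is an
    index of that colour. *)
Lemma adjoint_minimal_op : adjoint minimal_op = maximal_op.
Proof.
apply/seteqP; split=> [[x y] h|[x y] Bxy u v Auv /=]; last first.
  have /= E := Auv x y Bxy.
  by rewrite innerC -E -innerC.
have E k l : (k %% d = l %% d)%N ->
    (phi l)%:C * (fourier y k - (a k)%:C * fourier x k) =
    (phi k)%:C * (fourier y l - (a l)%:C * fourier x l).
  move=> kl; have /= := h _ _ (minimal_op_pair kl).
  rewrite /pair_vec /pair_img !innerBl !innerZl !inner_basisl.
  move=> /(congr1 Num.conj).
  rewrite !rmorphB !rmorphM /= !conjCK !conj_real => E.
  have -> : (phi l)%:C * (fourier y k - (a k)%:C * fourier x k) =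
    ((phi l)%:C * fourier y k - (phi k)%:C * fourier y l)
    - (phi l)%:C * (a k)%:C * fourier x k + (phi k)%:C * fourier y l by ring.
  by rewrite -E; ring.
exists (fun i => (fourier y i - (a i)%:C * fourier x i) / (phi i)%:C) => k /=.
have := E k (k %% d)%N; rewrite modn_mod => /(_ erefl) Ek.
apply: (mulfI (phi_neq0 (k %% d)%N)); rewrite Ek.
by field; exact: phi_neq0.
Qed.

Lemma minimal_op_symmetric : symmetric_operator minimal_op.
Proof.
move=> x y u v /minimal_op_maximal Bxy Auv.
by have /= -> := Auv x y Bxy.
Qed.

Lemma minimal_op_operator : operator minimal_op.
Proof.
split; first exact: subspace_adjoint.
move=> x y y' Axy Axy'; apply: (fourier_inj basis_e) => k.
by rewrite (minimal_op_diag k Axy) (minimal_op_diag k Axy').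
Qed.

(** A vector y orthogonal to the domain satisfies phi_l y_k = phi_k y_l for k,
    l of one colour.  As y_l stays bounded and phi_l does not, y_k = 0. *)
Lemma minimal_op_dense : dense (dom minimal_op).
Proof.
apply: dense_orthogonal.
  by apply: subspace_dom; exact: subspace_adjoint.
move=> y hy; apply: (fourier_eq0 basis_e) => k; apply: sqmod_eq0.
rewrite leNgt; apply/negP => s0.
pose N := (phi k * rnorm y) ^+ 2.
have [l lk hl] := phi_unbounded (N / sqmod (fourier y k) + 1) (ltn_pmod k d_gt0).
have : inner (pair_vec k l) y = 0.
  by apply: hy; exists (pair_img k l); exact: minimal_op_pair.
rewrite /pair_vec innerBl !innerZl !inner_basisl => /eqP.
rewrite subr_eq0 => /eqP /(congr1 (fun z => sqmod z)).
rewrite !sqmodM !sqmod_conj !sqmod_real => E.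
have : phi l ^+ 2 * sqmod (fourier y k) <= N.
  by rewrite E /N exprMn ler_wpM2l ?sqr_ge0 ?(fourier_le_rnorm basis_e).
have N0 : 0 <= N / sqmod (fourier y k) by rewrite divr_ge0 ?sqr_ge0 ?sqmod_ge0.
rewrite -ler_pdivlMr // leNgt => /negP; apply.
by move: hl N0; set w := N / _; nra.
Qed.

(** One generator f for each colour i.  If z is the eigenvalue a_j of an index
    j of colour i, the equation at j forces the constant of the colour to be 0
    and leaves x_j free; otherwise x_k is a multiple of phi_k / (z - a_k).  The
    index j is kept as a witness that f is not 0. *)
Lemma maximal_ker_colour z i : (i < d)%N -> exists f : H, exists j,
  [/\ fourier f j != 0, (j %% d = i)%N, forall k, (k %% d)%N != i -> fourier f k = 0,
      ker maximal_op z f &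
      forall x, ker maximal_op z x ->
        exists c, forall k, (k %% d = i)%N -> fourier x k = c * fourier f k].
Proof.
move=> id.
have [[j [ji zj]]|noj] := pselect (exists j, (j %% d = i)%N /\ z = (a j)%:C).
  exists (e j), j; split=> //.
  - by rewrite (fourier_basis basis_e) eqxx oner_neq0.
  - move=> k ki; rewrite (fourier_basis basis_e); case: eqVneq => // kj.
    by rewrite kj ji eqxx in ki.
  - exists (fun=> 0) => k /=; rewrite fourierZ (fourier_basis basis_e) mul0r zj.
    by have [->|] := eqVneq k j; rewrite ?subrr // !mulr0 subr0.
  move=> x [c hc]; exists (fourier x j) => k ki; rewrite (fourier_basis basis_e).
  have [->|kj] := eqVneq k j; first by rewrite mulr1.
  have := hc j; rewrite /= fourierZ ji zj subrr => /esym/eqP.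
  rewrite mulf_eq0 (negPf (phi_neq0 j)) orbF => /eqP c0.
  have := hc k; rewrite /= fourierZ ki c0 mul0r -mulrBl => /eqP.
  rewrite mulf_eq0 zj subr_eq0 => /orP[/eqP/complexI/a_inj jk|/eqP ->].
    by rewrite jk eqxx in kj.
  by rewrite mulr0.
have zk k : (k %% d = i)%N -> z - (a k)%:C != 0.
  by move=> ki; rewrite subr_eq0; apply/eqP => zk; apply: noj; exists k.
have [_ _ _ riesz_fischer] := basis_e.
have /riesz_fischer [f hf] : sqsummable (fun k =>
    if (k %% d == i)%N then (phi k)%:C / (z - (a k)%:C) else 0).
  apply: (@sqsummable_le _ _
    (fun k => sqmod ((phi k)%:C / (z - (a k)%:C)))) => [k|]; last first.
    exact: phi_resolvent.
  by case: ifP => // _; rewrite {1}/sqmod /= expr0n addr0 sqmod_ge0.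
exists f, i; have ii : (i %% d = i)%N by exact: modn_small.
split=> //.
- by rewrite hf ii eqxx mulf_neq0 ?phi_neq0 // invr_neq0 // zk.
- by move=> k /negPf ki; rewrite hf ki.
- exists (fun j => (j == i)%:R) => k /=; rewrite fourierZ hf.
  case: eqVneq => [ki|_]; last by rewrite !mulr0 subr0 mul0r.
  by rewrite -mulrBl mul1r mulrC divfK // zk.
move=> x [c hc]; exists (c i) => k ki; rewrite hf ki eqxx.
apply: (mulfI (zk k ki)); have := hc k; rewrite /= fourierZ ki -mulrBl => ->.
by rewrite mulrCA; congr (_ * _); rewrite mulrC divfK // zk.
Qed.

Lemma subspace_ker_maximal z : Defs.subspace (ker maximal_op z).
Proof.
by apply: subspace_ker; rewrite -adjoint_minimal_op; exact: subspace_adjoint.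
Qed.

Theorem has_dim_ker_maximal z : has_dim (ker maximal_op z) d.
Proof.
have /choice [f hf] : forall i : 'I_d, exists f : H, exists j,
  [/\ fourier f j != 0, (j %% d = i)%N, forall k, (k %% d)%N != i -> fourier f k = 0,
      ker maximal_op z f &
      forall x, ker maximal_op z x ->
        exists c, forall k, (k %% d = i)%N -> fourier x k = c * fourier f k].
  by move=> i; exact: maximal_ker_colour.
have ev (c : 'I_d -> R[i]) (i : 'I_d) k : (k %% d = i)%N ->
    fourier (\sum_(i < d) c i *: f i) k = c i * fourier (f i) k.
  move=> ki; rewrite fourier_sum (bigD1 i) //= fourierZ big1 ?addr0 // => i' i'i.
  have [j [_ _ supp _ _]] := hf i'; rewrite fourierZ supp ?mulr0 // ki.
  by apply: contra_neq i'i => E; apply: val_inj.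
exists f; split=> [c c0 i|].
  have [j [nz ji _ _ _]] := hf i.
  have := ev c i j ji; rewrite c0 fourier0 => /esym/eqP.
  by rewrite mulf_eq0 (negPf nz) orbF => /eqP.
apply/seteqP; split=> [x kx|x [c ->]].
  have /choice [c hc] : forall i : 'I_d, exists c, forall k,
      (k %% d = i)%N -> fourier x k = c * fourier (f i) k.
    by move=> i; have [j [_ _ _ _ h]] := hf i; exact: h.
  exists c; apply: (fourier_inj basis_e) => k; pose i := Ordinal (ltn_pmod k d_gt0).
  by rewrite (ev c i k erefl) -hc.
apply: subspace_sum => [|i]; last by have [j []] := hf i.
exact: subspace_ker_maximal.
Qed.

(** The projection q of e_k to M satisfies (q, a_k q) in A, because this pair is
    in the adjoint of the part of A in M, which is self-adjoint there.  So q is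
    a multiple of e_k, and testing it against the vector with coefficients
    phi_k / (i - a_k) gives q = 0. *)
Theorem minimal_op_simple : simple_operator minimal_op.
Proof.
move=> [M [sM cM M0 _ [_ _ _ saS]]]; apply: M0.
apply/seteqP; split=> [g Mg|_ ->]; last exact: sM.1.
apply: (fourier_eq0 basis_e) => k; rewrite -[fourier g k]/(inner g (e k)).
have [q Mq oq] := orthogonal_projection sM cM (e k).
have iq m : M m -> inner m (e k) = inner m q.
  by move=> Mm; apply/eqP; rewrite -subr_eq0 -innerBr oq.
suff q0 : q = 0 by rewrite iq // q0 inner0r.
have Aq : minimal_op (q, (a k)%:C *: q).
  suff : part M minimal_op (q, (a k)%:C *: q) by case.
  rewrite saS; split; last by split=> //; exact: subspaceZ.
  move=> u v [Auv [Mu Mv]] /=.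
  rewrite innerZr_real -!iq // -!/(fourier _ _).
  exact: minimal_op_diag.
have [t qE] : exists t, q = t *: e k.
  exists (fourier q k); apply: (fourier_inj basis_e) => j.
  rewrite fourierZ (fourier_basis basis_e).
  have [->|jk] := eqVneq j k; first by rewrite mulr1.
  have /eqP := minimal_op_diag j Aq.
  rewrite fourierZ -subr_eq0 -mulrBl mulf_eq0 subr_eq0 mulr0.
  by move=> /orP[/eqP/complexI/a_inj kj|/eqP //]; rewrite kj eqxx in jk.
have ni j : 'i - (a j)%:C != 0 by rewrite subr_eq0 eq_complex /= oner_eq0 andbF.
have [_ _ _ riesz_fischer] := basis_e.
have [x hx] := riesz_fischer _ (@phi_resolvent 'i).
have Bx : maximal_op (x, 'i *: x).
  exists (fun=> 1) => j /=; rewrite fourierZ -mulrBl mul1r hx.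
  by rewrite mulrC divfK.
have /= := Aq _ _ Bx.
rewrite qE innerZr_real innerZl !innerZr -!/(fourier _ _) => /eqP.
rewrite -subr_eq0 -mulrBl !mulf_eq0 (negPf (ni k)) conjC_eq0 hx mulf_eq0.
rewrite invr_eq0 (negPf (ni k)) (negPf (phi_neq0 k)) !orbF => /eqP ->.
by rewrite scale0r.
Qed.

Lemma rnorm_pair (s t : R) k l : k != l ->
  rnorm (s%:C *: e k - t%:C *: e l) ^+ 2 = s ^+ 2 + t ^+ 2.
Proof.
have ee i j : inner (e i) (e j) = (j == i)%:R.
  by rewrite -/(fourier _ _) (fourier_basis basis_e).
have n1 i : rnorm (e i) ^+ 2 = 1.
  by apply: complexI; rewrite -inner_rnorm ee eqxx.
move=> kl; rewrite rnorm_sqB !rnorm_scaleR !exprMn !n1 !mulr1.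
rewrite innerZl innerZr_real ee eq_sym (negPf kl) !mulr0 subr0.
by rewrite !real_normK ?num_real.
Qed.

Lemma pair_vec_neq0 k l : k != l -> pair_vec k l != 0.
Proof.
move=> kl; apply/eqP => p0; have := rnorm_pair (phi l) (phi k) kl.
rewrite -/(pair_vec k l) p0 -(scale0r 0) rnormZ normr0 mul0r expr0n => /eqP.
by rewrite lt_eqF // addr_gt0 // exprn_gt0.
Qed.

(** The pair vectors are approximate eigenvectors: both coordinates are
    multiplied by a factor close to c. *)
Lemma pair_approx (c h : R) k l : k != l ->
  `|a k - c| <= h -> `|a l - c| <= h ->
  rnorm (pair_img k l - c%:C *: pair_vec k l) <= h * rnorm (pair_vec k l).
Proof.
move=> kl hk hl; have h0 : 0 <= h by exact: le_trans hk.
rewrite -(@ler_pXn2r _ 2) ?nnegrE ?mulr_ge0 ?rnorm_ge0 // exprMn.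
have -> : pair_img k l - c%:C *: pair_vec k l =
    (phi l * (a k - c))%:C *: e k - (phi k * (a l - c))%:C *: e l.
  rewrite /pair_img /pair_vec scalerBr !scalerA opprB addrACA.
  rewrite -!rmorphM /= !mulrBr !rmorphB /= !scalerBl (mulrC c) (mulrC c).
  by rewrite opprB [RHS]addrACA; congr (_ + _); rewrite addrC.
rewrite !rnorm_pair // !exprMn mulrDr.
have sq t : `|t| <= h -> t ^+ 2 <= h ^+ 2.
  by move=> th; rewrite -[leLHS]real_normK ?num_real // ler_pXn2r ?nnegrE.
by rewrite !(mulrC (h ^+ 2)); apply: lerD; apply: ler_wpM2l; rewrite ?sqr_ge0 // sq.
Qed.

Section Accumulation.
Variable mu : R.
Hypothesis mu_accumulation : forall h : R, 0 < h -> exists k l,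
  [/\ k != l, (k %% d = l %% d)%N, mu < a k < mu + h & mu < a l < mu + h].

(** Pair vectors with a_k, a_l close to mu rule out a resolvent bound at mu.
    Those with a_k, a_l just above mu produce spectrum in [a_k, a_l], which
    consists of points close to mu and different from mu. *)
Theorem essential_spectrum_accumulation (T : set (H * H)) :
  selfadjoint T -> minimal_op `<=` T -> essential_spectrum T mu%:C.
Proof.
move=> saT AT; split.
  move=> /resolvent_bound [K K0 hK].
  have h0 : 0 < (2 * K)^-1 by rewrite invr_gt0 mulr_gt0.
  have [k [l [kl kld /andP[k1 k2] /andP[l1 l2]]]] := mu_accumulation h0.
  have := hK _ _ (AT _ (minimal_op_pair kld)).
  have := @pair_approx mu _ k l kl _ _.
  move=> /(_ (2 * K)^-1) ap.
  have {}ap : rnorm (pair_img k l - mu%:C *: pair_vec k l) <=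
             (2 * K)^-1 * rnorm (pair_vec k l).
    by apply: ap; rewrite ger0_norm ?subr_ge0 ?ltW // ltrBlDl.
  have := rnorm_gt0 (pair_vec_neq0 kl); set n := rnorm (pair_vec _ _) => n0.
  rewrite leNgt => /negP; apply.
  apply: le_lt_trans (ler_wpM2l (ltW K0) ap) _.
  rewrite -/n mulrA invfM mulrCA mulfV ?gt_eqF // mulr1.
  by rewrite gtr_pMl // invf_lt1 // ltr1n.
move=> [[_ [V nV VS]] _ _].
have /nbhs_ballP [_ /= /gt0_complexP [r r0 ->] hV] : nbhs (mu%:C : R[i]^o) V by [].
have [k [l [kl kld /andP[k1 k2] /andP[l1 l2]]]] := mu_accumulation r0.
pose c := (a k + a l) / 2; pose h := `|a k - a l| / 2.
have Tp := AT _ (minimal_op_pair kld).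
have n1 := ler_norm (a k - a l).
have n2 : - (a k - a l) <= `|a k - a l| by rewrite -normrN ler_norm.
have hk : `|a k - c| <= h by rewrite ler_norml /c /h; apply/andP; split; lra.
have hl : `|a l - c| <= h by rewrite ler_norml /c /h; apply/andP; split; lra.
have [s sc Ss] :=
  selfadjoint_spectrum_near saT Tp (pair_vec_neq0 kl) (pair_approx kl hk hl).
have [smu sr] : mu < s /\ s < mu + r.
  move: sc; rewrite /h /c ler_norml; case: (lerP (a l) (a k)) => alk.
    by move=> /andP[s1 s2]; split; lra.
  by move=> /andP[s1 s2]; split; lra.
have : (V `&` spectrum T) s%:C.
  split=> //; apply: hV; rewrite /ball /= -rmorphB /= normc_def /= expr0n addr0.
  by rewrite sqrtr_sqr ltcR distrC ger0_norm; lra.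
by rewrite VS => /complexI sE; rewrite sE ltxx in smu.
Qed.

End Accumulation.

(** The vector (a_k - mu) on P, formally the image of the indicator of P, is
    corrected at the single index l so as to become orthogonal to the kernel of
    A* - mu, which is the orthogonal complement of the range.  If the range were
    closed it would contain the corrected vector y; a preimage of y has all its
    coefficients on P equal to 1, so it cannot be square summable. *)
Theorem minimal_op_ran_not_closed (mu : R) (P : pred nat) l :
  (forall k, a k != mu) ->
  (forall k, P k -> (k %% d = 0)%N) ->
  (forall N, exists2 k, (N <= k)%N & P k) ->
  sqsummable (fun k => if P k then (a k - mu)%:C else 0) ->
  ~~ P l -> (l %% d = 0)%N ->
  ~ closed (ran minimal_op mu%:C).
Proof.
move=> amu P0 Pinf sP Pl l0 cN.
have [_ _ _ riesz_fischer] := basis_e.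
have [y0 hy0] := riesz_fischer _ sP.
have muk k : mu%:C - (a k)%:C != 0.
  rewrite -rmorphB /=; apply/eqP => /complexI/eqP.
  by rewrite subr_eq0 eq_sym (negPf (amu k)).
have [g hg] := riesz_fischer _ (@phi_resolvent mu%:C).
have gl : inner (e l) g != 0.
  by rewrite inner_basisl conjC_eq0 hg mulf_neq0 ?phi_neq0 // invr_neq0.
pose t := inner y0 g / inner (e l) g.
pose y := y0 - t *: e l.
have yg : inner y g = 0 by rewrite innerBl innerZl /t divfK // subrr.
have yk k : fourier y k = (if P k then (a k - mu)%:C else 0) - t * (k == l)%:R.
  by rewrite fourierB fourierZ hy0 (fourier_basis basis_e).
have ysupp k : (k %% d != 0)%N -> fourier y k = 0.
  move=> k0; rewrite yk; case: ifP => [/P0 E|_]; first by rewrite E eqxx in k0.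
  have -> : k == l = false by apply: contraNF k0 => /eqP ->; rewrite l0.
  by rewrite mulr0 subr0.
have sA := subspace_adjoint maximal_op.
have [q Nq oq] := orthogonal_projection (subspace_ran mu%:C sA) cN y.
have [c hc] : maximal_op (y - q, mu%:C *: (y - q)).
  rewrite -adjoint_minimal_op => u v Auv /=.
  rewrite innerZr_real; apply/eqP; rewrite -subr_eq0 -innerZl -innerBl.
  by apply/eqP/oq; exists (u, v).
have yf : inner y (y - q) = 0.
  rewrite -[y - q](subrK (c 0%N *: g)) innerDr innerZr yg mulr0 addr0.
  apply: (inner_disjoint basis_e) => k.
  have [k0|k0] := eqVneq (k %% d)%N 0%N; last by rewrite ysupp // mul0r.
  suff -> : fourier (y - q - c 0%N *: g) k = 0 by rewrite rmorph0 mulr0.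
  apply/eqP; rewrite fourierB fourierZ subr_eq0; apply/eqP.
  apply: (mulfI (muk k)); have := hc k; rewrite /= k0 fourierZ -mulrBl => ->.
  by rewrite hg mulrCA; congr (_ * _); rewrite mulrC divfK.
have : y - q = 0.
  by apply: inner_eq0; rewrite innerBl yf oq // subrr.
move=> /eqP; rewrite subr_eq0 => /eqP yq; move: Nq; rewrite -yq.
move=> [[u v] /= Auv uvy].
have [N hN] : exists N, forall k, (N <= k)%N -> sqmod (fourier u k) < 1.
  by have [_ su _ _] := basis_e; exact: sqsummable_decay (su u) ltr01.
have [k Nk Pk] := Pinf N.
have kl : k == l = false by apply: contraNF Pl => /eqP <-.
have : fourier u k = 1.
  have := yk k; rewrite -uvy Pk kl mulr0 subr0 fourierB fourierZ.
  rewrite (minimal_op_diag k Auv) -mulrBl -[RHS]mulr1 rmorphB /=.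
  by apply: mulfI; rewrite -opprB oppr_eq0.
by have := hN k Nk => /[swap] ->; rewrite /sqmod /= expr1n expr0n addr0 ltxx.
Qed.

End DiagonalOperator.
(** * Eigenvalues and weights *)

Lemma infinite_range (T : Type) (S : set T) (f : nat -> T) :
  injective f -> (forall n, S (f n)) -> infinite_set S.
Proof.
move=> f_inj fS finS; apply: infinite_nat.
rewrite (_ : setT = f @^-1` S); first by apply: finite_preimage finS => ? ? _ _ /f_inj.
by apply/seteqP; split=> n // _; exact: fS.
Qed.

Lemma half_power_small (R : realType) (h : R) : 0 < h ->
  exists N, forall k, (N <= k)%N -> (2^-1 : R) ^+ k < h.
Proof.
move=> h0; have /cvg_expr /cvgrPdist_lt /(_ h h0) [N _ hN] : `|2^-1 : R| < 1.
  by rewrite ger0_norm // invf_lt1 // ltr1n.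
exists N => k Nk; have := hN k Nk.
by rewrite /= sub0r normrN ger0_norm // exprn_ge0.
Qed.

Section Nodes.
Variables (R : realType) (d : nat).
Hypothesis d_gt0 : (0 < d)%N.
Implicit Types (k l m : nat) (z : R[i]).

Local Notation q := (2^-1 : R).

(** Each value of the level is taken infinitely often on every residue class
    modulo d.  Indices of level 0 carry the unbounded eigenvalues and weights,
    those of level m > 0 the eigenvalues that accumulate at 2^-m. *)
Definition level k : nat := logn 2 (k %/ d).+1.

Lemma level_le k : (level k <= k)%N.
Proof.
by rewrite -ltnS; apply: leq_trans (ltn_logl 2 (ltn0Sn _)) _; rewrite ltnS leq_div.
Qed.

Lemma level_infinite i m N : (i < d)%N ->
  exists k, [/\ (N <= k)%N, (k %% d = i)%N & level k = m].
Proof.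
move=> id; pose n := (2 ^ m * (2 * N).+1)%N.
have n0 : (0 < n)%N by rewrite muln_gt0 expn_gt0.
(* n has 2-adic valuation m, and n.-1 is the quotient of the witness by d *)
exists (n.-1 * d + i)%N; split.
- apply: leq_trans (leq_addr _ _); apply: leq_trans (leq_pmulr _ d_gt0).
  rewrite -ltnS prednK //; apply: leq_trans (leq_pmull _ _); last by rewrite expn_gt0.
  by rewrite ltnS leq_pmull.
- by rewrite modnMDl modn_small.
rewrite /level divnMDl // (divn_small id) addn0 prednK // /n.
rewrite lognM ?expn_gt0 // pfactorK // logn_coprime ?addn0 //.
by rewrite coprime2n /= mul2n odd_double.
Qed.

Definition node k : R :=
  if level k == 0%N then 4 ^+ k else q ^+ level k * (1 + q ^+ k.+1).

Definition weight k : R :=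
  if level k == 0%N then 2 ^+ k else q ^+ k * q ^+ k.

Let q_gt0 k : 0 < q ^+ k. Proof. by rewrite exprn_gt0. Qed.

Let q_lt1 : q < 1. Proof. by rewrite invf_lt1 // ltr1n. Qed.

Let q_anti k l : (k <= l)%N -> q ^+ l <= q ^+ k.
Proof. by move=> kl; rewrite ler_wiXn2l // ltW. Qed.

Let q_le1 k : q ^+ k <= 1.
Proof. by rewrite -(expr0 q) q_anti. Qed.

Let qS k : q ^+ k = 2 * q ^+ k.+1.
Proof. by rewrite exprS mulrA mulfV // mul1r. Qed.

Let q_inj : injective (GRing.exp q).
Proof. by apply: ieexprIn => //; rewrite lt_eqF. Qed.

Lemma node_cell k : level k != 0%N ->
  q ^+ level k < node k /\ node k <= q ^+ level k * (3 / 2).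
Proof.
move=> lk; rewrite /node (negPf lk).
have := q_gt0 (level k); have := q_gt0 k.+1.
have : q ^+ k.+1 <= q by rewrite exprS ger_pMr.
by move: (q ^+ k.+1) (q ^+ level k) => s t *; split; nra.
Qed.

Lemma node_ge1 k : level k = 0%N -> 1 <= node k.
Proof. by move=> lk; rewrite /node lk /= exprn_ege1 // ler1n. Qed.

(** The nodes of level m > 0 lie in ]2^-m, 3/2 2^-m], and those of any other
    level lie outside [2^-m, 3/2 2^-m]. *)
Lemma node_separated m k : (0 < m)%N ->
  level k != m -> node k < q ^+ m \/ q ^+ m * (3 / 2) < node k.
Proof.
case: m => // m _; have qm := q_gt0 m.+1; case: (ltngtP (level k) m.+1) => // lkm _.
  right; have [lk|lk] := eqVneq (level k) 0%N.
    apply: lt_le_trans (node_ge1 lk); have := q_le1 m; rewrite qS; lra.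
  apply: lt_le_trans (_ : q ^+ level k <= _); last by have [/ltW] := node_cell lk.
  by have := q_anti (lkm : (level k <= m)%N); rewrite (qS m); lra.
left; have lk : level k != 0%N by rewrite -lt0n (leq_trans _ lkm).
apply: le_lt_trans (node_cell lk).2 _.
by have := q_anti lkm; rewrite (qS m.+1); have := q_gt0 m.+2; lra.
Qed.

Lemma node_inj : injective node.
Proof.
have sep k l : level l != 0%N -> level k != level l -> node k <> node l.
  move=> ll kl E; have := node_cell ll; rewrite -E => -[c1 c2].
  have l0 : (0 < level l)%N by rewrite lt0n.
  by case: (node_separated l0 kl); lra.
move=> k l E; have [lk|lk] := eqVneq (level k) (level l); last first.
  have [l0|l0] := eqVneq (level l) 0%N; last by case: (sep k l).
  have k0 : level k != 0%N by rewrite -l0.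
  by case: (sep l k k0 _ (esym E)); rewrite eq_sym.
move: E; rewrite /node lk; case: eqP => [_|/eqP l0].
  by apply: ieexprIn => //; rewrite gt_eqF // ltr1n.
by move=> /(mulfI (lt0r_neq0 (q_gt0 _))) /addrI /q_inj [].
Qed.

Lemma weight_gt0 k : 0 < weight k.
Proof. by rewrite /weight; case: ifP => _; rewrite ?mulr_gt0 // exprn_gt0. Qed.

Lemma weight_unbounded i (C : R) : (i < d)%N ->
  exists2 k, (k %% d = i)%N & C < weight k.
Proof.
move=> id; have C0 : 0 < `|C| + 1 by rewrite ltr_wpDl.
have /half_power_small [N hN] : 0 < (`|C| + 1)^-1 by rewrite invr_gt0.
have [k [Nk ki lk]] := level_infinite 0 N id.
exists k => //; rewrite /weight lk /=; have := hN k Nk.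
rewrite exprVn ltf_pV2 ?posrE ?exprn_gt0 // => h.
by have := ler_norm C; lra.
Qed.

Lemma node_diff k m : level k = m -> (0 < m)%N ->
  node k - q ^+ m = q ^+ m * q ^+ k.+1.
Proof.
move=> lk m0; rewrite /node lk ifF; last by rewrite gtn_eqF.
by rewrite mulrDr mulr1 addrAC subrr add0r.
Qed.

Local Notation rnormc := (@rnorm R R[i]^o).

Lemma rnormc_real (r : R) : rnormc r%:C = `|r|.
Proof. by rewrite /rnorm normc_def /= expr0n addr0 sqrtr_sqr. Qed.

Lemma rnormc_sqr z : rnormc z ^+ 2 = sqmod z.
Proof.
by rewrite /rnorm normc_def /= sqr_sqrtr // addr_ge0 ?sqr_ge0.
Qed.

Lemma rnormc_le (z w : R[i]) : rnormc z <= rnormc (z - w) + rnormc w.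
Proof. by have := @rnormD R R[i]^o (z - w) w; rewrite subrK. Qed.

(** The points 2^-m accumulate only at 0. *)
Lemma dyadic_separated z : z != 0 -> exists2 h : R, 0 < h &
  forall m, (q ^+ m)%:C != z -> h <= rnormc (z - (q ^+ m)%:C).
Proof.
move=> z0; have r0 : 0 < rnormc z by exact: (@rnorm_gt0 R R[i]^o).
have [M hM] := half_power_small (divr_gt0 r0 (ltr0n R 2)).
have [h h0 hh] : exists2 h : R, 0 < h & forall m, (m < M)%N ->
    (q ^+ m)%:C != z -> h <= rnormc (z - (q ^+ m)%:C).
  elim: M {hM} => [|M [h h0 hh]]; first by exists 1.
  have [E|E] := eqVneq (q ^+ M)%:C z.
    exists h => // m; rewrite ltnS leq_eqVlt => /predU1P[->|mM]; last exact: hh.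
    by rewrite E eqxx.
  have n0 : 0 < rnormc (z - (q ^+ M)%:C).
    by apply: (@rnorm_gt0 R R[i]^o); rewrite subr_eq0 eq_sym.
  exists (Num.min h (rnormc (z - (q ^+ M)%:C))); first by rewrite lt_min h0.
  move=> m; rewrite ltnS leq_eqVlt => /predU1P[-> _|mM mz].
    by rewrite ge_min lexx orbT.
  by rewrite ge_min hh.
exists (Num.min h (rnormc z / 2)); first by rewrite lt_min h0 divr_gt0.
move=> m mz; rewrite ge_min; case: (ltnP m M) => mM; first by rewrite hh.
apply/orP; right; have := hM m mM.
have := rnormc_le z (q ^+ m)%:C.
by rewrite rnormc_real (ger0_norm (ltW (q_gt0 m))); lra.
Qed.

(** For z = 0 compare with 2^-level.  If z is one of the points 2^-m, the nodes
    of level m are at distance 2^-m 2^-(k+1) from it.  In all other cases z has a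
    positive distance to 2^-level, and the nodes are asymptotically equal to
    2^-level. *)
Lemma node_lower_bound z : exists2 c : R, 0 < c & exists N, forall k,
  (N <= k)%N -> level k != 0%N -> c * q ^+ k <= rnormc (z - (node k)%:C).
Proof.
have [->|z0] := eqVneq z 0.
  exists 1 => //; exists 0%N => k _ lk.
  rewrite sub0r rnormN rnormc_real mul1r.
  apply: le_trans (ler_norm _); have [/ltW + _] := node_cell lk.
  by apply: le_trans; apply: q_anti; exact: level_le.
have [h h0 hh] := dyadic_separated z0.
have r0 : 0 < rnormc z by exact: (@rnorm_gt0 R R[i]^o).
have [N hN] := half_power_small (divr_gt0 h0 (ltr0n R 2)).
exists (Num.min (h / 2) (rnormc z / 2)); first by rewrite lt_min !divr_gt0.
exists N => k Nk lk; have lk0 : (0 < level k)%N by rewrite lt0n.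
have nd := node_diff erefl lk0.
have qk := q_gt0 k; have qk1 := q_le1 k.
have t0 : 0 <= q ^+ level k * q ^+ k.+1 by rewrite mulr_ge0 // ltW.
have [E|E] := eqVneq (q ^+ level k)%:C z.
  rewrite -E -rmorphB /= !rnormc_real distrC nd !ger0_norm ?(ltW (q_gt0 _)) //.
  set s := Num.min _ _; have sle : s <= q ^+ level k / 2 by rewrite ge_min lexx orbT.
  apply: le_trans (ler_wpM2r (ltW qk) sle) _.
  by rewrite (qS k) mulrA divfK.
set s := Num.min _ _; have sle : s <= h / 2 by rewrite ge_min lexx.
apply: le_trans (ler_wpM2r (ltW qk) sle) _.
have := hh _ E; have := hN k Nk.
have := rnormc_le (z - (q ^+ level k)%:C) (z - (node k)%:C) => tri.
have E1 : z - (q ^+ level k)%:C - (z - (node k)%:C) =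
    (q ^+ level k * q ^+ k.+1)%:C.
  by rewrite opprB addrAC addrCA subrr addr0 -nd rmorphB.
move: tri; rewrite E1 rnormc_real ger0_norm //.
have : q ^+ level k * q ^+ k.+1 <= q ^+ k.
  apply: le_trans (q_anti (leqnSn k)).
  by rewrite ger_pMl.
by nra.
Qed.

(** At level 0, 2^k <= 2 2^-k |z - 4^k| for large k; at the other levels,
    4^-k <= 2^-k |z - node k| / c with c from the lower bound above. *)
Lemma weight_bound z : exists2 K : R, 0 < K & exists N, forall k, (N <= k)%N ->
  weight k <= K * q ^+ k * rnormc (z - (node k)%:C).
Proof.
have [c c0 [N hN]] := node_lower_bound z.
have z1 : 0 < rnormc z + 1 by rewrite ltr_wpDl ?rnorm_ge0.
have [N' hN'] : exists N', forall k, (N' <= k)%N -> q ^+ k < (2 * (rnormc z + 1))^-1.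
  by apply: half_power_small; rewrite invr_gt0 mulr_gt0.
exists (c^-1 + 2); first by rewrite addr_gt0 // invr_gt0.
exists (N + N')%N => k Nk; have qk := q_gt0 k.
have n0 : 0 <= rnormc (z - (node k)%:C) by exact: rnorm_ge0.
rewrite -mulrA mulrDl; have [lk|lk] := eqVneq (level k) 0%N.
  apply: le_trans (_ : 2 * (q ^+ k * rnormc (z - (node k)%:C)) <= _); last first.
    by rewrite lerDr !mulr_ge0 ?invr_ge0 // ltW.
  have pk : 2 ^+ k * q ^+ k = 1 :> R by rewrite -exprMn mulfV ?expr1n.
  have p0 : 0 < 2 ^+ k :> R by rewrite exprn_gt0.
  have E : node k = 2 ^+ k * 2 ^+ k by rewrite /node lk /= -exprMn -natrM.
  have := hN' k (leq_trans (leq_addl _ _) Nk).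
  rewrite exprVn ltf_pV2 ?posrE ?mulr_gt0 // => h.
  have := rnormc_le (node k)%:C z.
  rewrite rnormc_real (@rnormB R R[i]^o) ger0_norm => [tri|]; last first.
    by rewrite E mulr_ge0 // ltW.
  have P2 : 2 ^+ k * 2 ^+ k <= 2 * rnormc (z - (node k)%:C).
    have p1 : 1 <= 2 ^+ k :> R by rewrite exprn_ege1 // ler1n.
    have r0 : 0 <= rnormc z by exact: rnorm_ge0.
    by move: tri h; rewrite E; nra.
  rewrite /weight lk /=; apply: (@le_trans _ _ (2 ^+ k * 2 ^+ k * q ^+ k)).
    by rewrite -mulrA pk mulr1.
  by rewrite exprVn (mulrC (2 ^- k)) mulrA ler_wpM2r // invr_ge0 ltW.
have := hN k (leq_trans (leq_addr _ _) Nk) lk => h.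
apply: le_trans (_ : c^-1 * (q ^+ k * rnormc (z - (node k)%:C)) <= _); last first.
  by rewrite lerDl !mulr_ge0 // ltW.
rewrite /weight (negPf lk) mulrCA ler_pM2l //.
by rewrite ler_pdivlMl.
Qed.

Lemma weight_resolvent z : sqsummable (fun k => (weight k)%:C / (z - (node k)%:C)).
Proof.
have [K K0 [N hN]] := weight_bound z.
apply: (@sqsummable_geometric _ _ (K ^+ 2) N) => k Nk.
have h := hN k Nk; have w0 := weight_gt0 k; have qk := q_gt0 k.
have n0 : 0 < rnormc (z - (node k)%:C).
  by rewrite -(pmulr_rgt0 _ (mulr_gt0 K0 qk)) (lt_le_trans w0).
rewrite sqmodM sqmodV sqmod_real -rnormc_sqr ler_pdivrMr ?exprn_gt0 //.
apply: (@le_trans _ _ ((K * q ^+ k * rnormc (z - (node k)%:C)) ^+ 2)).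
  by rewrite ler_pXn2r ?nnegrE ?mulr_ge0 ?(ltW w0) ?(ltW K0) ?(ltW qk) ?(ltW n0).
rewrite !exprMn ler_wpM2r ?sqr_ge0 // ler_wpM2l ?sqr_ge0 //.
by rewrite expr2 ger_pMl.
Qed.

End Nodes.
Lemma open_interval_affine (R : realType) (mu1 mu2 : \bar R) : (mu1 < mu2)%E ->
  exists2 r : R, 0 < r & exists alpha : R, forall t, 0 < t < 1 ->
    open_interval mu1 mu2 (alpha + r * t).
Proof.
rewrite /open_interval; case: mu1 mu2 => [x| |] [y| |] //=; rewrite ?lte_fin => xy.
- exists (y - x); first by rewrite subr_gt0.
  by exists x => t /andP[t0 t1]; rewrite !lte_fin; split; nra.
- exists 1 => //; exists x => t /andP[t0 t1]; rewrite lte_fin ltey; split=> //; lra.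
- exists 1 => //; exists (y - 1) => t /andP[t0 t1].
  by rewrite lte_fin ltNye; split=> //; lra.
- by exists 1 => //; exists 0 => t _; rewrite ltey ltNye.
Qed.

(** * Transport to the given interval *)

Section ScaledNodes.
Variables (R : realType) (d : nat) (alpha r : R).
Hypotheses (d_gt0 : (0 < d)%N) (r_gt0 : 0 < r).
Implicit Types (k l m : nat).

Local Notation q := (2^-1 : R).

Definition eigenvalue_seq k : R := alpha + r * node R d k.

(** The index is shifted by one because level 0 is the unbounded part. *)
Definition accumulation_value m : R := alpha + r * q ^+ m.+1.

Lemma eigenvalue_seq_inj : injective eigenvalue_seq.
Proof. by move=> k l /addrI /(mulfI (lt0r_neq0 r_gt0)) /node_inj. Qed.

Lemma accumulation_value_inj : injective accumulation_value.
Proof.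
move=> k l /addrI /(mulfI (lt0r_neq0 r_gt0)) E; apply/eqP; rewrite -eqSS.
by apply/eqP; apply: ieexprIn E; rewrite ?lt_eqF // invf_lt1 // ltr1n.
Qed.

Lemma eigenvalue_seq_resolvent (z : R[i]) :
  sqsummable (fun k => (weight R d k)%:C / (z - (eigenvalue_seq k)%:C)).
Proof.
have r0 : r%:C != 0 :> R[i] by rewrite gt_eqF // ltr0C.
have := @sqsummable_combination R r%:C^-1 _ _
  (@weight_resolvent R d ((z - alpha%:C) / r%:C))
  (@l2_sqsummable R 0).
rewrite (_ : (fun k => _) =
  (fun k => (weight R d k)%:C / (z - (eigenvalue_seq k)%:C))) //.
apply/funext => k; rewrite l20 addr0.
have -> : z - (eigenvalue_seq k)%:C =
    r%:C * ((z - alpha%:C) / r%:C - (node R d k)%:C).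
  by rewrite /eigenvalue_seq rmorphD rmorphM /=; field.
by rewrite invfM mulrCA mulrA.
Qed.

Lemma accumulation_value_diff k m : level d k = m.+1 ->
  eigenvalue_seq k - accumulation_value m = r * (q ^+ m.+1 * q ^+ k.+1).
Proof.
move=> lk; rewrite -(node_diff R lk) // /eigenvalue_seq /accumulation_value; ring.
Qed.

Lemma accumulation_value_neq k m : eigenvalue_seq k != accumulation_value m.
Proof.
have [lk|lk] := eqVneq (level d k) m.+1.
  by rewrite -subr_eq0 accumulation_value_diff // !mulf_neq0 // ?expf_neq0 // gt_eqF.
rewrite -subr_eq0 /eigenvalue_seq /accumulation_value opprD addrACA subrr add0r -mulrBr.
apply: mulf_neq0; first by rewrite gt_eqF.
rewrite subr_eq0.
have q0 : 0 < q ^+ m.+1 by rewrite exprn_gt0.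
rewrite neq_lt; case: (node_separated R (ltn0Sn m) lk) => [-> //|h].
by apply/orP; right; lra.
Qed.

Lemma accumulation_value_accumulation m (h : R) : 0 < h -> exists k l,
  [/\ k != l, (k %% d = l %% d)%N,
      accumulation_value m < eigenvalue_seq k < accumulation_value m + h &
      accumulation_value m < eigenvalue_seq l < accumulation_value m + h].
Proof.
move=> h0.
have close k : level d k = m.+1 -> q ^+ k < h / r ->
    accumulation_value m < eigenvalue_seq k < accumulation_value m + h.
  move=> lk; rewrite ltr_pdivlMr // => hk.
  have := accumulation_value_diff lk.
  have s0 : 0 < q ^+ m.+1 * q ^+ k.+1 by rewrite mulr_gt0 // exprn_gt0.
  have s1 : q ^+ m.+1 * q ^+ k.+1 <= q ^+ k.
    rewrite (exprS q k) mulrA ger_pMl ?exprn_gt0 // -exprSr.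
    by rewrite exprn_ile1 // ltW // invf_lt1 // ltr1n.
  have := ler_wpM2l (ltW r_gt0) s1; have := mulr_gt0 r_gt0 s0.
  rewrite (mulrC r (q ^+ k)).
  by move: (r * _) hk => s hk ? ? ?; apply/andP; split; lra.
have [N hN] := half_power_small (divr_gt0 h0 r_gt0).
have [k [Nk k0 lk]] := level_infinite d_gt0 m.+1 N d_gt0.
have [l [kl l0 ll]] := level_infinite d_gt0 m.+1 k.+1 d_gt0.
exists k, l; split.
- by rewrite neq_ltn kl.
- by rewrite k0 l0.
- by apply: close => //; exact: hN.
- by apply: close => //; apply: hN; rewrite (leq_trans Nk) // ltnW.
Qed.

Lemma accumulation_value_sqsummable m (P : pred nat) :
  (forall k, P k -> level d k = m.+1) ->
  sqsummable (fun k => if P k then (eigenvalue_seq k - accumulation_value m)%:C else 0).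
Proof.
move=> hP; apply: (@sqsummable_geometric _ _ (r ^+ 2) 0) => k _.
have q1 n : q ^+ n <= 1 by rewrite exprn_ile1 // ltW // invf_lt1 // ltr1n.
have q0 n : 0 < q ^+ n by rewrite exprn_gt0.
case: ifP => [/hP lk|_]; last first.
  by rewrite /sqmod /= expr0n addr0 mulr_ge0 ?sqr_ge0 ?ltW.
rewrite sqmod_real accumulation_value_diff // exprMn ler_wpM2l ?sqr_ge0 //.
rewrite expr2 (exprSr q k) -!mulrA mulrCA ger_pMr //.
have h1 : q <= 1 by rewrite invf_le1 // ler1n.
by rewrite !mulr_ile1 ?mulr_ge0 ?(ltW (q0 _)).
Qed.

End ScaledNodes.

Unset Implicit Arguments.

Theorem proposition3p6 (R : realType) (mu1 mu2 : \bar R) (hmu : (mu1 < mu2)%E)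
    (d : nat) (hd : (1 <= d)%N) :
  exists (H : hilbertSpace R) (A : set (H * H)),
    separable H /\
    [/\ operator A, closed A, dense (dom A),
        symmetric_operator A & simple_operator A] /\
    deficiency_indices A d d /\
    (forall l : R, open_interval mu1 mu2 l -> has_dim (ker (adjoint A) l%:C) d) /\
    rho_tilde (open_interval mu1 mu2) A = open_interval mu1 mu2 /\
    (forall T : set (H * H), selfadjoint T -> A `<=` T ->
       infinite_set [set l : R | open_interval mu1 mu2 l /\
                                 essential_spectrum T l%:C]) /\
    infinite_set (rho_tilde (open_interval mu1 mu2) A `\`
                  rho_hat (open_interval mu1 mu2) A).
Proof.
have [r r0 [alpha hI]] := open_interval_affine hmu.
have basis := @l2_hilbert_basis R.
pose a := eigenvalue_seq d alpha r; pose phi := weight R d.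
have ai : injective a by exact: eigenvalue_seq_inj.
have p0 : forall k, 0 < phi k by move=> k; exact: weight_gt0.
have pu : forall i (C : R), (i < d)%N -> exists2 l, (l %% d = i)%N & C < phi l.
  by move=> i C; exact: weight_unbounded.
have pr z : sqsummable (fun k => (phi k)%:C / (z - (a k)%:C)).
  exact: eigenvalue_seq_resolvent.
pose A := minimal_op (@l2_delta R) d a phi.
pose mu := accumulation_value alpha r.
have muI m : open_interval mu1 mu2 (mu m).
  by apply: hI; rewrite exprn_gt0 //= exprn_ilt1 //= invf_lt1 // ltr1n.
have kerA z : has_dim (ker (adjoint A) z) d.
  by rewrite adjoint_minimal_op //; exact: has_dim_ker_maximal.
have defA : deficiency_indices A d d by split=> z _; exact: kerA.
have rhoT : rho_tilde (open_interval mu1 mu2) A = open_interval mu1 mu2.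
  by apply/seteqP; split=> [l []|l Il] //; split=> //; exists d.
exists (l2_hilbert R), A; split; first exact: l2_separable.
split.
  split.
  - exact: minimal_op_operator.
  - exact: closed_adjoint.
  - exact: minimal_op_dense.
  - exact: minimal_op_symmetric.
  - exact: minimal_op_simple.
split; first exact: defA.
split; first by move=> l _; exact: kerA.
split; first exact: rhoT.
have mu_inj : injective mu by exact: accumulation_value_inj.
split=> [T saT AT|].
  apply: (infinite_range mu_inj) => m; split; first exact: muI.
  apply: essential_spectrum_accumulation saT AT => //.
  by move=> h; exact: accumulation_value_accumulation.
apply: (infinite_range mu_inj) => m; split; first by rewrite rhoT; exact: muI.
move=> [_ [_ cran]].
pose P k := (level d k == m.+1) && (k %% d == 0)%N.
apply: (minimal_op_ran_not_closed basis p0 pr (P := P) (l := 0) _ _ _ _ _ _ cran).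
- by move=> k; exact: accumulation_value_neq.
- by move=> k /andP[_ /eqP].
- move=> N; have [k [Nk k0 lk]] := level_infinite hd m.+1 N hd.
  by exists k => //; rewrite /P lk k0 !eqxx.
- by apply: accumulation_value_sqsummable => // k /andP[/eqP].
- by rewrite /P /level div0n logn1.
- exact: mod0n.
Qed.
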